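(* Let $\gamma>1/2$, $\lambda>0$, $\varepsilon$ real with $2\lambda+2\varepsilon>0$, and let $\omega_0>1$, $\omega>1$ with $\omega_0\omega>\omega_0+1$. Let $\sigma>1$ be such that $K=1$ (i.e. the look-ahead function satisfies $l_{N,\sigma}(n)=n+1$ for all $n<N$), and assume that $\omega_0$ is large enough that $$\frac{c_3}{c_6}\ge\frac12,\qquad \frac{c_1\omega_0\omega}{2\gamma-1}\ge 1,\qquad \frac{c_4}{c_1}\le 2 .$$ Assume furthermore that $n_{opt}$ exists. Then for any $N$ (including $N=\infty$) and any $\tau\ge1$, the parameter $$n_{fb}=\min\{n : b_{N,\sigma}(n)<\tau\}$$ exists with probability $1$, and the oracle inequality $$\mathbb{E}\,\|x_{n_{fb}}^\delta-x\|^2\le C\,\min_n \mathbb{E}\,\|x_n^\delta-x\|^2$$ holds, where the constant $C$ does not depend on the particular $x$ and $\xi$ (i.e. it depends neither on $\delta$ nor on $\eta$).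
   Context: Setting. $\mathcal X,\mathcal Y$ are separable real infinite-dimensional Hilbert spaces with orthonormal bases $(u_k)_{k\ge1}$, $(v_k)_{k\ge1}$, and $A:\mathcal X\to\mathcal Y$ is the compact injective operator $Ax=\sum_{k\ge1}\mathfrak s_k\langle x,u_k\rangle v_k$ with singular values $\mathfrak s_k=k^{-\lambda}$, $\lambda>0$. The data are $y^\delta=Ax+\xi$, where the noise $\xi$ is given through its coordinates $\langle\xi,v_k\rangle$ (it need not belong to $\mathcal Y$). Stochastic model: $\langle x,u_k\rangle\sim\mathcal N(0,(\eta k^{-\gamma})^2)$ and $\langle\xi,v_k\rangle\sim\mathcal N(0,(\delta k^{\varepsilon})^2)$ for $k\ge1$, all these Gaussian variables independent, with $\eta,\delta>0$, $\gamma>1/2$, $\lambda>-\varepsilon$. $\mathbb E$ and $\mathbb P$ refer to the joint law of $x$ and $\xi$. Regularization (truncated SVD). For integers $n\ge0$, $s(n)=\lceil\omega_0\omega^n\rceil$ with $\omega_0,\omega>1$, $\omega_0\omega>\omega_0+1$, and $$x_n^\delta=\sum_{k=1}^{s(n)-1}\big(\langle x,u_k\rangle+\mathfrak s_k^{-1}\langle\xi,v_k\rangle\big)u_k .$$ Noise behaviour: $\varrho(n)\ge 0$ with $\varrho(n)^2=\mathbb E\big\|\sum_{k=1}^{s(n)-1}\mathfrak s_k^{-1}\langle\xi,v_k\rangle u_k\big\|^2$. Balancing functional. $N\in\mathbb N\cup\{\infty\}$ is a maximal regularization parameter with $n_{opt}<N$. For $\sigma>1$, $l_{N,\sigma}(n)=\min\{\min\{m:\varrho(n)^{-1}>\sigma\varrho(m)^{-1}\},N\}$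 is the look-ahead function; it is assumed to have the form $l_{N,\sigma}(n)=n+K$ (capped at $N$) for a fixed integer $K\ge 1$. The balancing functional is $$b_{N,\sigma}(n)=\max_{n<m\le l_{N,\sigma}(n)}\tfrac14\|x_n^\delta-x_m^\delta\|\,\varrho(m)^{-1}$$ (a maximum over the empty set is $0$). The index $n$ in the definition of $n_{fb}$ ranges over integers $0\le n\le N$ ($n\ge0$ if $N=\infty$). Optimal parameter. $n_{opt}$ is the solution of $$\frac{\eta^2\omega_0^{-2\gamma+1}}{2\gamma-1}\omega^{n_{opt}(-2\gamma+1)}=\frac{\delta^2\omega_0^{2\lambda+2\varepsilon+1}}{2\lambda+2\varepsilon+1}\omega^{n_{opt}(2\lambda+2\varepsilon+1)} ,$$ i.e. $n_{opt}=\log\Big(\big(\frac{\eta^2}{\delta^2}\frac{2\lambda+2\varepsilon+1}{2\gamma-1}\big)^{1/(2\lambda+2\varepsilon+2\gamma)}\omega_0^{-1}\Big)/\log\omega$; ''$n_{opt}$ exists'' means that this number is $\ge0$. Constants. $$c_1=\min\Big\{\big(\tfrac{\omega_0+1}{\omega_0}\big)^{-2\gamma+1}(1-\omega^{-2\gamma+1}),\ \big(\tfrac{\omega_0-1}{\omega_0}\big)^{2\lambda+2\varepsilon+1}(1-\omega^{-2\lambda-2\varepsilon-1})\Big\},$$ $$c_3=\big(\tfrac{\omega_0-1}{\omega_0}\big)^{2\lambda+2\varepsilon+1}(1-\omega^{-2\lambda-2\varepsilon-1}),\qquad c_4=\big(\tfrac{\omega_0+1}{\omega_0}\big)^{1+2\lambda+2\varepsilon},$$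 $$c_6=\max\Big\{\big(\tfrac{\omega_0-1}{\omega_0}\big)^{-2\gamma+1},\ \big(\tfrac{\omega_0+1}{\omega_0}\big)^{1+2\lambda+2\varepsilon}\Big\}.$$ *)

(* Defs.v *)
From HB Require Import structures.
From mathcomp Require Import all_boot all_order all_algebra.
From mathcomp Require Import sesquilinear.
From mathcomp Require Import all_classical all_reals all_analysis.

Set Implicit Arguments.
Unset Strict Implicit.
Unset Printing Implicit Defensive.

Import Order.TTheory GRing.Theory Num.Theory.
Import numFieldNormedType.Exports.

Local Open Scope classical_set_scope.
Local Open Scope ring_scope.

(* Sequences indexed by k >= 1 in the mathematics are indexed here by
   j = k - 1 : nat; the index k then appears as j.+1. *)

Section hilbert.
Context {R : realType}.

(* Together with the completeness of X, this makes (X, ip) a real Hilbert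
   space. *)
Definition norm_from_dot (X : completeNormedModType R)
    (ip : {dot X for idfun}) :=
  forall x : X, `|x| ^+ 2 = ip x x.

(* An infinite orthonormal basis, so that X is separable and of infinite
   dimension. *)
Definition orthonormal_basis (X : completeNormedModType R)
    (ip : {dot X for idfun}) (u : nat -> X) :=
  (forall i j, ip (u i) (u j) = (i == j)%:R) /\
  (forall x : X, series (fun j => ip x (u j) *: u j) @ \oo --> x).

Definition sing_val (lambda : R) (j : nat) : R := j.+1%:R `^ (- lambda).

(* For the null sequence of nonzero numbers sing_val lambda (lambda > 0), this
   forces A to be linear, compact and injective. *)
Definition has_svd (X Y : completeNormedModType R) (ipX : {dot X for idfun})
    (u : nat -> X) (v : nat -> Y) (s : nat -> R) (A : X -> Y) :=
  forall x : X, series (fun j => (s j * ipX x (u j)) *: v j) @ \oo --> A x.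

End hilbert.

Section probability.
Context {R : realType} {d : measure_display} {T : measurableType d}.
Variable P : probability T R.

(* normal_prob is an integral over an arbitrary set, whence the restriction to
   measurable sets. *)
Definition normal_law (Z : T -> R) (m s : R) :=
  measurable_fun setT Z /\
  (forall B : set R, measurable B -> P (Z @^-1` B) = normal_prob m s B).

Definition mutually_independent (I : choiceType) (Z : I -> T -> R) :=
  forall (J : seq I) (B : I -> set R), uniq J ->
    (forall i, i \in J -> measurable (B i)) ->
    P (\bigcap_(i in [set` J]) (Z i @^-1` B i)) =
    (\prod_(i <- J) P (Z i @^-1` B i))%E.

(* xi j stands for <xi, v_{j+1}>: the noise is only given by its coordinates. *)
Record gaussian_model (X : completeNormedModType R) (ip : {dot X for idfun})
    (u : nat -> X) (x : T -> X) (xi : nat -> T -> R)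
    (eta delta gamma eps : R) : Prop := {
  law_solution : forall j,
    normal_law (fun w => ip (x w) (u j)) 0 (eta * j.+1%:R `^ (- gamma));
  law_noise : forall j, normal_law (xi j) 0 (delta * j.+1%:R `^ eps);
  independent_coordinates :
    mutually_independent (fun i : nat + nat =>
      match i with
      | inl j => fun w => ip (x w) (u j)
      | inr j => xi j
      end) }.

End probability.

(* A number N in {0, 1, ...} u {oo} is an option nat, None being oo. *)
Section cap.
Context {R : realType}.

Definition le_cap (N : option nat) (r : R) : bool :=
  if N is Some m then r <= m%:R else true.

Definition lt_cap (N : option nat) (r : R) : bool :=
  if N is Some m then r < m%:R else true.

End cap.

Definition min_cap (N : option nat) (n : nat) : nat :=
  if N is Some m then minn n m else n.

(* The minimum of Q; the value 0 for the empty set is a dummy: it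
   plays no role in look_ahead, where noise_level is unbounded as soon as
   lambda + eps > 0, and n_fb takes it only where no admissible n exists. *)
Definition least (Q : set nat) : nat :=
  xget 0%N [set m | Q m /\ forall m', Q m' -> (m <= m')%N].

Section truncated_svd.
Context {R : realType}.
Variables (omega0 omega : R).

Definition trunc_level (n : nat) : nat := `|Num.ceil (omega0 * omega ^+ n)|%N.

Context {d : measure_display} {T : measurableType d}.
Variable P : probability T R.
Context {X : completeNormedModType R}.
Variables (ip : {dot X for idfun}) (u : nat -> X).
Variables (lambda : R) (x : T -> X) (xi : nat -> T -> R).

Definition tsvd (n : nat) (w : T) : X :=
  \sum_(j < (trunc_level n).-1)
    (ip (x w) (u j) + (sing_val lambda j)^-1 * xi j w) *: u j.

Definition noise_part (n : nat) (w : T) : X :=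
  \sum_(j < (trunc_level n).-1) ((sing_val lambda j)^-1 * xi j w) *: u j.

Definition noise_level (n : nat) : R :=
  Num.sqrt (fine 'E_P[fun w => (`|noise_part n w| ^+ 2)%R]%E).

Definition look_ahead (N : option nat) (sigma : R) (n : nat) : nat :=
  min_cap N
    (least [set m | (noise_level n)^-1 > sigma * (noise_level m)^-1]).

Definition balancing (N : option nat) (sigma : R) (n : nat) (w : T) : R :=
  \big[Num.max/0]_(n.+1 <= m < (look_ahead N sigma n).+1)
    (4^-1 * `|tsvd n w - tsvd m w| * (noise_level m)^-1).

Definition fb_admissible (N : option nat) (sigma tau : R) (w : T) : set nat :=
  [set n | le_cap N (n%:R : R) /\ balancing N sigma n w < tau].

Definition n_fb (N : option nat) (sigma tau : R) (w : T) : nat :=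
  least (fb_admissible N sigma tau w).

Definition mean_sq_error (n : T -> nat) : \bar R :=
  'E_P[fun w => (`|tsvd (n w) w - x w| ^+ 2)%R]%E.

End truncated_svd.

Section constants.
Context {R : realType}.
Variables (gamma lambda eps omega0 omega : R).

Definition is_n_opt (eta delta nopt : R) : Prop :=
  eta ^+ 2 * omega0 `^ (- 2 * gamma + 1) / (2 * gamma - 1)
    * omega `^ (nopt * (- 2 * gamma + 1)) =
  delta ^+ 2 * omega0 `^ (2 * lambda + 2 * eps + 1)
      / (2 * lambda + 2 * eps + 1)
    * omega `^ (nopt * (2 * lambda + 2 * eps + 1)).

Definition c3 : R :=
  ((omega0 - 1) / omega0) `^ (2 * lambda + 2 * eps + 1)
  * (1 - omega `^ (- 2 * lambda - 2 * eps - 1)).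

Definition c1 : R :=
  Num.min
    (((omega0 + 1) / omega0) `^ (- 2 * gamma + 1)
      * (1 - omega `^ (- 2 * gamma + 1)))
    (((omega0 - 1) / omega0) `^ (2 * lambda + 2 * eps + 1)
      * (1 - omega `^ (- 2 * lambda - 2 * eps - 1))).

Definition c4 : R := ((omega0 + 1) / omega0) `^ (1 + 2 * lambda + 2 * eps).

Definition c6 : R :=
  Num.max
    (((omega0 - 1) / omega0) `^ (- 2 * gamma + 1))
    (((omega0 + 1) / omega0) `^ (1 + 2 * lambda + 2 * eps)).

End constants.

(* Main.v *)
(* Write D n for the number of coefficients kept at level n, S_n for the squared
   noise error (sum over j < D n) and T_n for the squared bias (sum over
   j >= D n), so that the squared error of x_n is S_n + T_n. With
   g = 2 gamma - 1 and b = 2 lambda + 2 eps + 1, E T_n and E S_n are comparable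
   to U omega^(- g (n - n_opt)) and U omega^(b (n - n_opt)), where U is the
   common value in the equation of n_opt; hence min_n E|x_n - x|^2 >= c U, and
   an error of order U at the stopping index n_fb is all that is needed.
   - Stopping too early, n_fb = i < n_opt: the balancing functional only
     controls the block [D i, D (i+1)), where it bounds the bias by the noise.
     The rest T_(i+1) of the bias is independent of that block, and a Chernoff
     bound shows that the block is that small with probability
     O(E S_(i+1) / E T_i) (this needs blocks of length at least 2, which the
     condition c3 / c6 >= 1/2 ensures). So early stopping at i costs
     O(E S_(i+1)), which is summable over i < n_opt.
   - Stopping too late, n_fb > i >= n_opt + const: the block [D i, D (i+1)) is
     exceptionally large, which by a Chernoff bound has probability
     exp(- const omega^i); this beats the growth of E S_i. When n_fb = i + 2,
     splitting S_(i+2) at D (i+1) and using the event of the other block for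
     each part makes the events independent of the errors they multiply.
   The only probabilistic input is thus E exp(t Z^2) = (1 - 2 t s^2)^(-1/2) for
   Z ~ N(0, s^2), together with the product rule for independent variables. *)

Require Import Defs.
From HB Require Import structures.
From mathcomp Require Import all_boot all_order all_algebra.
From mathcomp Require Import sesquilinear.
From mathcomp Require Import all_classical all_reals all_analysis.
From mathcomp Require Import measurable_realfun simple_functions zify ring lra.

Set Implicit Arguments.
Unset Strict Implicit.
Unset Printing Implicit Defensive.

Import Order.TTheory GRing.Theory Num.Theory.
Import numFieldNormedType.Exports.

Local Open Scope classical_set_scope.
Local Open Scope ring_scope.

(** * Integrals of functions of a random variable *)

Section integration.
Context {R : realType}.
Import HBNNSimple.

(** Monotone convergence along simple approximations of [f]. Each approximating sum sees [phi] only
    through indicators, so a weighted integral is determined by its values on indicators. *)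
Lemma cvg_weighted_approx d (T : measurableType d) (m : {measure set T -> \bar R})
    (h phi : T -> R) (f : R -> R) (mf : measurable_fun [set: R] (fun y => (f
      y)%:E)) :
  (forall x, 0 <= h x) -> measurable_fun setT h -> measurable_fun setT phi ->
  (forall y, 0 <= f y) ->
  (fun n => \sum_(y \in range (nnsfun_approx measurableT mf n))
     (y%:E * \int[m]_x (h x *
        \1_(nnsfun_approx measurableT mf n @^-1` [set y]) (phi x))%:E))%E @ \oo
    --> (\int[m]_x (h x * f (phi x))%:E)%E.
Proof.
move=> h0 mh mphi f0; set k := nnsfun_approx _ mf.
have mk n : measurable_fun setT (k n) by exact/measurable_funP.
have mkphi n : measurable_fun setT (fun x => k n (phi x)).
  exact: measurableT_comp.
have mpre n y : measurable (k n @^-1` [set y]) by exact: measurable_sfunP.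
have mind n y : measurable_fun setT
    (fun x => \1_(k n @^-1` [set y]) (phi x) : R).
  by apply: measurableT_comp => //; exact: measurable_indic.
suff sumE n : (\sum_(y \in range (k n))
     (y%:E * \int[m]_x (h x * \1_(k n @^-1` [set y]) (phi x))%:E) =
     \int[m]_x (h x * k n (phi x))%:E)%E.
  under eq_fun do rewrite sumE.
  have -> : (\int[m]_x (h x * f (phi x))%:E =
       \int[m]_x (limn (fun n => (h x * k n (phi x))%:E)))%E.
    apply: eq_integral => x _; apply/esym/cvg_lim => //.
    under eq_fun do rewrite EFinM.
    rewrite EFinM; apply: cvgeZl => //.
    by apply: (@cvg_nnsfun_approx _ _ _ _ measurableT _ mf) => // y _;
      rewrite lee_fin.
  apply: cvg_monotone_convergence => //.
  - by move=> n; apply/measurable_EFinP; exact: measurable_funM.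
  - by move=> n x _; rewrite lee_fin mulr_ge0.
  - move=> x _ a b ab; rewrite lee_fin ler_wpM2l//.
    exact/lefP/(nd_nnsfun_approx measurableT mf).
transitivity (\int[m]_x (\sum_(y \in range (k n))
    (h x * (y * \1_(k n @^-1` [set y]) (phi x)))%:E))%E; last first.
  apply: eq_integral => x _.
  rewrite (fimfunE (k n)) fsumEFin//; congr (_%:E).
  rewrite !fsbig_finite//= mulr_sumr; exact: eq_bigr.
rewrite ge0_integral_fsum//.
- apply: eq_fsbigr => y /[!inE] -[z _ kzy].
  rewrite -ge0_integralZl_EFin//.
  + by apply: eq_integral => x _; rewrite -EFinM mulrCA.
  + by move=> x _; rewrite lee_fin mulr_ge0.
  + by apply/measurable_EFinP; exact: measurable_funM.
  + by rewrite -kzy.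
- move=> y; apply/measurable_EFinP; apply: measurable_funM => //.
  by apply: measurable_funM.
- move=> y x _; rewrite lee_fin mulr_ge0//.
  by have := nnfun_muleindic_ge0 (k n) y (phi x); rewrite -EFinM lee_fin.
Qed.

(** The simple sums of the two sides agree term by term, hence so do their limits. The weights let
    one principle serve both for a density and for independence, where the weight is the product of
    the other factors. *)
Lemma eq_weighted_integral d1 (T1 : measurableType d1)
    (m1 : {measure set T1 -> \bar R}) (h1 phi1 : T1 -> R)
    d2 (T2 : measurableType d2)
    (m2 : {measure set T2 -> \bar R}) (h2 phi2 : T2 -> R) (f : R -> R) :
  (forall x, 0 <= h1 x) -> measurable_fun setT h1 -> measurable_fun setT phi1 ->
  (forall x, 0 <= h2 x) -> measurable_fun setT h2 -> measurable_fun setT phi2 ->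
  (forall B : set R, measurable B ->
    \int[m1]_x (h1 x * \1_B (phi1 x))%:E =
    \int[m2]_x (h2 x * \1_B (phi2 x))%:E)%E ->
  (forall y, 0 <= f y) -> measurable_fun setT f ->
  (\int[m1]_x (h1 x * f (phi1 x))%:E = \int[m2]_x (h2 x * f (phi2 x))%:E)%E.
Proof.
move=> h10 mh1 mphi1 h20 mh2 mphi2 eqB f0 mf.
have mF : measurable_fun [set: R] (fun y => (f y)%:E) by exact/measurable_EFinP.
have c1 := cvg_weighted_approx (m:=m1) mF h10 mh1 mphi1 f0.
have c2 := cvg_weighted_approx (m:=m2) mF h20 mh2 mphi2 f0.
apply: (cvg_unique _ c1) => //.
rewrite (_ : (fun n => _) = (fun n =>
  \sum_(y \in range (nnsfun_approx measurableT mF n))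
     (y%:E * \int[m2]_x (h2 x *
       \1_(nnsfun_approx measurableT mF n @^-1` [set y]) (phi2 x))%:E))%E)//.
apply/funext => n; apply: eq_fsbigr => y _.
by rewrite eqB//; exact: measurable_sfunP.
Qed.

End integration.

(** * Independent Gaussian variables *)

Section independence.
Context {R : realType} {d : measure_display} {T : measurableType d}.
Variable P : probability T R.

Lemma measurable_prod_comp (I : eqType) (V : I -> T -> R) (f : I -> R -> R)
    (J : seq I) :
  (forall i, measurable_fun setT (V i)) ->
  (forall i, measurable_fun setT (f i)) ->
  measurable_fun setT (fun w => \prod_(i <- J) f i (V i w)).
Proof.
move=> mV mf; elim: J => [|i J ih].
  by under eq_fun do rewrite big_nil; exact: measurable_cst.
under eq_fun do rewrite big_cons.
by apply: measurable_funM => //; exact: measurableT_comp.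
Qed.

Lemma integral_prod_indep (I : choiceType) (V : I -> T -> R) (f : I -> R -> R)
    (m : I -> R) (J : seq I) :
  mutually_independent P V -> (forall i, measurable_fun setT (V i)) ->
  (forall i y, 0 <= f i y) -> (forall i, measurable_fun setT (f i)) ->
  uniq J -> (forall i, i \in J -> \int[P]_w (f i (V i w))%:E = (m i)%:E)%E ->
  (\int[P]_w (\prod_(i <- J) f i (V i w))%:E = (\prod_(i <- J) m i)%:E)%E.
Proof.
move=> indV mV f0 mf uJ EJ.
have mpre i B : measurable B -> measurable (V i @^-1` B).
  by move=> mB; rewrite -[X in measurable X]setTI; exact: mV.
(* The functions are freed from indicators to arbitrary f one index at a time,
   so the induction carries a second list J2 still bearing indicators. *)
suff gen J2 (B : I -> set R) : uniq (J ++ J2) ->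
    (forall i, measurable (B i)) ->
    (\int[P]_w (\prod_(i <- J) f i (V i w) *
                \prod_(i <- J2) \1_(B i) (V i w))%:E =
     (\prod_(i <- J) m i * \prod_(i <- J2) fine (P (V i @^-1` B i)))%:E)%E.
  have := gen [::] (fun=> setT); rewrite cats0 => /(_ uJ (fun=> measurableT)).
  under eq_integral do rewrite big_nil mulr1.
  by rewrite big_nil mulr1.
elim: J uJ EJ J2 B => [_ _|i J ih /= /andP[iJ uJ] EJ] J2 B uJ2 mB.
  rewrite big_nil mul1r.
  under eq_integral do rewrite big_nil mul1r.
  (* A product of indicators is the indicator of an intersection, so the base case is
     [mutually_independent] itself. *)
  rewrite (_ : (fun w => _) = (fun w =>
      (\1_(\bigcap_(i in [set` J2]) (V i @^-1` B i)) w)%:E)); last first.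
    apply/funext => w; congr (_%:E); rewrite indicE.
    case: (boolP (w \in _)) => [/[!inE] wB|wB].
      rewrite big_seq big1// => i iJ2; rewrite indicE mem_set//.
      exact: wB.
    have [i iJ2 wi] : exists2 i, i \in J2 & ~ B i (V i w).
      apply: contrapT => /forall2NP H; move/negP: wB; apply; rewrite inE => i iJ2.
      by have [//|/contrapT] := H i.
    rewrite (big_rem _ iJ2)/= indicE memNset// mul0r//.
  rewrite integral_indic// ?setIT; last first.
    by apply: fin_bigcap_measurable => // i _; exact: mpre.
  apply: etrans (indV J2 B _ _) _ => //.
  rewrite (big_morph EFin EFinM (erefl _)); apply: eq_bigr => i _.
  by rewrite fineK// fin_num_measure//; exact: mpre.
have {}ih := ih uJ (fun j jJ => EJ j (@mem_behead _ (i :: J) j jJ)).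
move: uJ2 => /= /andP[]; rewrite mem_cat negb_or => /andP[_ iJ2] uJ2.
pose B' B0 j := if j == i then B0 else B j.
set c := \prod_(i <- J) m i * \prod_(j <- J2) fine (P (V j @^-1` B j)).
have c0 : 0 <= c.
  apply: mulr_ge0; last by apply: prodr_ge0 => j _; exact: fine_ge0.
  rewrite big_seq; apply: prodr_ge0 => j jJ.
  rewrite -lee_fin -EJ ?inE ?jJ ?orbT// integral_ge0// => w _.
  by rewrite lee_fin.
set h := fun w => \prod_(j <- J) f j (V j w) * \prod_(j <- J2) \1_(B j) (V j w).
transitivity (\int[P]_w (h w * f i (V i w))%:E)%E.
  by apply: eq_integral => w _; rewrite big_cons /h; congr (_%:E); ring.
have h0 w : 0 <= h w.
  by rewrite /h mulr_ge0// prodr_ge0.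
have mh : measurable_fun setT h.
  apply: measurable_funM; first exact: measurable_prod_comp.
  apply: (@measurable_prod_comp _ V (fun j => \1_(B j))) => // j.
(* Replaces the weight [h], the product of the other factors, by the constant [c]. On indicators of
   [V i] this is the induction hypothesis with [i] moved to the list that carries indicators. *)
rewrite (@eq_weighted_integral _ _ _ P h (V i) _ _ P (cst c) (V i))//.
  rewrite (_ : (fun x => _) = (fun x => c%:E * (f i (V i x))%:E))%E//.
  rewrite ge0_integralZl_EFin//.
  - rewrite EJ ?mem_head// -EFinM /c big_cons; congr (_%:E).
    ring.
  - by move=> w _; rewrite lee_fin.
  - by apply/measurable_EFinP; exact: measurableT_comp.
move=> B0 mB0.
have := ih (i :: J2) (B' B0).
have -> : uniq (J ++ i :: J2).
  move: uJ2; rewrite !cat_uniq /= => /and3P[-> hJ ->].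
  by rewrite negb_or iJ hJ iJ2.
have mB' j : measurable (B' B0 j) by rewrite /B'; case: ifP.
move=> /(_ isT mB') H.
have eJ2 (F : I -> set R -> R) :
    \prod_(j <- J2) F j (B' B0 j) = \prod_(j <- J2) F j (B j).
  rewrite !big_seq; apply: eq_bigr => j jJ2; rewrite /B'.
  by case: eqP => // ji; move: iJ2; rewrite -ji jJ2.

transitivity (\int[P]_w
   (\prod_(i0 <- J) f i0 (V i0 w) *
    \prod_(i0 <- (i :: J2)) \1_(B' B0 i0) (V i0 w))%:E)%E.
  apply: eq_integral => w _; rewrite big_cons (eJ2 (fun j B => \1_B (V j w))).
  by rewrite {1}/B' eqxx /h; congr (_%:E); ring.
rewrite H big_cons (eJ2 (fun j B => fine (P (V j @^-1` B)))) {1}/B' eqxx.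
rewrite (_ : (fun x => _) = (fun x => c%:E * (\1_(V i @^-1` B0) x)%:E))%E//.
rewrite ge0_integralZl_EFin//.
- rewrite integral_indic// ?setIT; last exact: mpre.
  transitivity (c%:E * (fine (P (V i @^-1` B0)))%:E)%E; last first.
    by congr (_ * _)%E; rewrite fineK// fin_num_measure//; exact: mpre.
  by rewrite -EFinM /c; congr (_%:E); ring.
- by apply/measurable_EFinP; apply: measurable_indic; exact: mpre.
Qed.

End independence.

Section gaussian.
Context {R : realType} {d : measure_display} {T : measurableType d}.
Variable P : probability T R.

(** With q^2 = 1 - 2 t s^2, the density of N(0, s^2) times exp(t y^2) is 1/q times the density of
    N(0, (s/q)^2), which has integral 1. *)
Lemma normal_exp_moment (Z : T -> R) (s t : R) :
  normal_law P Z 0 s -> 0 < s -> 2 * t * s ^+ 2 < 1 ->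
  (\int[P]_w (expR (t * Z w ^+ 2))%:E =
   ((Num.sqrt (1 - 2 * t * s ^+ 2))^-1)%:E)%E.
Proof.
move=> [mZ lawZ] s0 ts; set q := Num.sqrt _.
have q0 : 0 < q by rewrite sqrtr_gt0 subr_gt0.
have q2 : q ^+ 2 = 1 - 2 * t * s ^+ 2 by rewrite sqr_sqrtr// subr_ge0 ltW.
have mE : measurable_fun [set: R] (fun y => expR (t * y ^+ 2) : R).
  apply: measurableT_comp => //; apply: measurable_funM => //.
have := @eq_weighted_integral R _ _ P (cst 1) Z _ _
  (@lebesgue_measure R) (normal_pdf 0 s) id (fun y => expR (t * y ^+ 2)).
move=> /(_ _ _ _ _ _ _ _ _ _)/=; rewrite (_ : (fun x => _) =
  (fun w => (expR (t * Z w ^+ 2))%:E))%E; last first.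
  by apply/funext => w; rewrite mul1r.
move=> -> //.
- rewrite (_ : (fun x => _) =
      (fun x => (q^-1)%:E * (normal_pdf 0 (s / q) x)%:E))%E; last first.
    apply/funext => x; rewrite -EFinM; congr (_%:E).
    rewrite !normal_pdfE ?gt_eqF ?divr_gt0// /normal_peak /normal_fun.
    rewrite -mulrA -expRD subr0.
    have -> : - x ^+ 2 / (s ^+ 2 *+ 2) + t * x ^+ 2 =
              - x ^+ 2 / ((s / q) ^+ 2 *+ 2).
      have -> : t = (1 - q ^+ 2) / (2 * s ^+ 2).
        by rewrite q2; field; rewrite gt_eqF.
      by field; rewrite !gt_eqF.
    rewrite mulrA; congr (_ * _).
    have pi2 : 0 <= pi *+ 2 :> R by rewrite mulrn_wge0// pi_ge0.
    have sqrtE r : 0 < r -> Num.sqrt (r ^+ 2 * pi *+ 2) = r * Num.sqrt (pi *+ 2).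
      move=> r0; rewrite -mulrnAr sqrtrM ?sqr_ge0//.
      by congr (_ * _); rewrite sqrtr_sqr gtr0_norm.
    rewrite !sqrtE ?divr_gt0//.
    have : Num.sqrt (pi *+ 2) != 0 :> R.
      by rewrite sqrtr_eq0 -ltNge mulrn_wgt0// pi_gt0.
    by move=> pi0; field; rewrite pi0 (gt_eqF q0) (gt_eqF s0).
  rewrite ge0_integralZl_EFin//.
  + by rewrite integral_normal_pdf mule1.
  + by move=> x _; rewrite lee_fin normal_pdf_ge0.
  + by apply/measurable_EFinP; exact: measurable_normal_pdf.
  + by rewrite invr_ge0 ltW.
- by move=> x; exact: normal_pdf_ge0.
- exact: measurable_normal_pdf.
- move=> B mB; transitivity (normal_prob 0 s B).
    rewrite -lawZ// (_ : (fun x => _) =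
      (fun x => (\1_(Z @^-1` B) x)%:E))%E; last first.
      by apply/funext => w; rewrite mul1r.
    rewrite integral_indic ?setIT// -[X in measurable X]setTI; exact: mZ.
  rewrite /normal_prob integral_mkcond; apply: eq_integral => x _.
  rewrite patchE indicE; case: ifP => _; first by rewrite mulr1.
  by rewrite mulr0.
Qed.

End gaussian.

(** * Moments and Chernoff bounds for squared Gaussians *)

Section squared_gaussians.
Context {R : realType} {d : measure_display} {T : measurableType d}.
Variable P : probability T R.
Variables (I : choiceType) (V : I -> T -> R) (s c : I -> R).
Hypothesis s_gt0 : forall i, 0 < s i.
Hypothesis c_gt0 : forall i, 0 < c i.
Hypothesis lawV : forall i, normal_law P (V i) 0 (s i).
Hypothesis indV : mutually_independent P V.

Let Q i w := (c i * V i w) ^+ 2.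
Let v i := (c i * s i) ^+ 2.

Let mV i : measurable_fun setT (V i).
Proof. by case: (lawV i). Qed.

Lemma measurable_sq i : measurable_fun setT (Q i).
Proof. by apply: measurable_funX; apply: measurable_funM. Qed.

Let v_gt0 i : 0 < v i.
Proof. by rewrite /v exprn_gt0// mulr_gt0. Qed.

Lemma sq_exp_moment i t : 2 * t * v i < 1 ->
  (\int[P]_w (expR (t * Q i w))%:E = ((Num.sqrt (1 - 2 * t * v i))^-1)%:E)%E.
Proof.
move=> tv; have e : 2 * t * v i = 2 * (t * c i ^+ 2) * s i ^+ 2.
  by rewrite /v exprMn; ring.
rewrite e -(normal_exp_moment (lawV i)) -?e//.
by apply: eq_integral => w _; rewrite /Q exprMn mulrA.
Qed.

Let mexp i t : measurable_fun setT (fun w => (expR (t * Q i w))%:E).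
Proof.
apply/measurable_EFinP; apply: measurableT_comp => //.
by apply: measurable_funM => //; exact: measurable_sq.
Qed.

Let mQ i : measurable_fun setT (fun w => (Q i w)%:E).
Proof. by apply/measurable_EFinP; exact: measurable_sq. Qed.

(** Integrate t Q <= exp(t Q) with t v = 3/8, where the exponential moment is 2; the resulting 16/3
    is rounded up to 6. *)
Lemma sq_moment_le i : (\int[P]_w (Q i w)%:E <= (6 * v i)%:E)%E.
Proof.
have v0 := v_gt0 i; pose t := 3 / 8 / v i.
have t0 : 0 < t by rewrite divr_gt0// divr_gt0.
have tv : 2 * t * v i = 3 / 4 by rewrite /t; field; rewrite gt_eqF.
have := @sq_exp_moment i t; rewrite tv => /(_ ltac:(lra)).
have -> : 1 - 3 / 4 = (1 / 2) ^+ 2 :> R by field.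
rewrite sqrtr_sqr ger0_norm// => E.
have : (\int[P]_w (t%:E * (Q i w)%:E) <= \int[P]_w (expR (t * Q i w))%:E)%E.
  apply: ge0_le_integral => //.
  - by move=> w _; rewrite -EFinM lee_fin mulr_ge0// ?sqr_ge0// ltW.
  - by apply: measurable_funeM.
  - move=> w _; rewrite -EFinM lee_fin.
    by rewrite (le_trans _ (expR_ge1Dx _))// lerDr.
rewrite E ge0_integralZl_EFin ?(ltW t0)//; last first.
  by move=> w _; rewrite lee_fin sqr_ge0.
rewrite -(@lee_pdivlMl R t)// => /le_trans; apply.
rewrite -EFinM lee_fin /t.
have -> : (3 / 8 / v i)^-1 * (1 / 2)^-1 = 16 / 3 * v i.
  by field; rewrite gt_eqF.
by rewrite ler_wpM2r ?(ltW v0)//; lra.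
Qed.

(** Integrate 1 <= exp(- t Q) + t Q with t v = 1/2: the exponential moment is 1/sqrt 2 <= 3/4, so t
    times the mean of Q is at least 1/4. *)
Lemma sq_moment_ge i : ((v i / 2)%:E <= \int[P]_w (Q i w)%:E)%E.
Proof.
have v0 := v_gt0 i; pose t := 1 / 2 / v i.
have t0 : 0 < t by rewrite divr_gt0// divr_gt0.
have tv : 2 * - t * v i = - 1 by rewrite /t; field; rewrite gt_eqF.
have := @sq_exp_moment i (- t); rewrite tv opprK => /(_ ltac:(lra)) E.
have : (\int[P]_w (cst 1 w) <=
    \int[P]_w ((expR (- t * Q i w))%:E + t%:E * (Q i w)%:E))%E.
  apply: ge0_le_integral => //.
  - by apply: emeasurable_funD => //; apply: measurable_funeM.
  - move=> w _; rewrite -EFinM -EFinD lee_fin -lerBlDr.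
    by have := expR_ge1Dx (- t * Q i w); rewrite mulNr.
rewrite (@integral_cst _ _ _ P setT) // mul1e [X in (X <= _)%E -> _](_ : _ =
  1%E); last exact: probability_setT.
rewrite ge0_integralD//; first last.
- by apply: measurable_funeM.
- by move=> w _; rewrite -EFinM lee_fin mulr_ge0 ?sqr_ge0// (ltW t0).
rewrite E ge0_integralZl_EFin ?(ltW t0)//; last first.
  by move=> w _; rewrite lee_fin sqr_ge0.
have h : (Num.sqrt (1 + 1))^-1 <= 3 / 4 :> R.
  have r0 : 0 < Num.sqrt (1 + 1) :> R by rewrite sqrtr_gt0.
  have r2 : Num.sqrt (1 + 1) ^+ 2 = 2 :> R by rewrite sqr_sqrtr.
  rewrite -[leLHS]mul1r ler_pdivrMr//.
  nra.
move=> H; have : ((1 / 4)%:E <= t%:E * \int[P]_w (Q i w)%:E)%E.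
  move: H; rewrite -(@leeBlDl R 1%E)//; apply: le_trans.
  by rewrite -EFinB lee_fin; lra.
rewrite -(@lee_pdivrMl R t)// => /(le_trans _); apply.
by rewrite -EFinM lee_fin /t le_eqVlt; apply/orP; left; apply/eqP; field;
  rewrite gt_eqF.
Qed.

(** The exponential of [a] plus the weighted sum dominates the indicator of [F], and independence
    factors its mean. A square with index outside [J] is one more independent factor, so on [F] its
    mean shrinks by the same [p]. The weights may have either sign. *)
Lemma sq_chernoff (J : seq I) (t : I -> R) (a p : R) (F : set T) :
  uniq J -> (forall i, i \in J -> 2 * t i * v i < 1) -> measurable F ->
  (forall w, F w -> 0 <= a + \sum_(i <- J) t i * Q i w) ->
  expR a * \prod_(i <- J) (Num.sqrt (1 - 2 * t i * v i))^-1 <= p ->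
  (P F <= p%:E)%E /\
  forall k, k \notin J -> (\int[P]_w (Q k w * \1_F w)%:E <= (p * (6 * v k))%:E)%E.
Proof.
move=> uJ tv mF Fa ap.
pose f i (y : R) := expR (t i * (c i * y) ^+ 2).
have mf i : measurable_fun setT (f i).
  apply: measurableT_comp => //; apply: measurable_funM => //.
  by apply: measurable_funX; apply: measurable_funM.
have fE w : expR a * \prod_(i <- J) f i (V i w) =
    expR (a + \sum_(i <- J) t i * Q i w).
  by rewrite expRD expR_sum.
have mprod : measurable_fun setT (fun w => \prod_(i <- J) f i (V i w)).
  exact: measurable_prod_comp.
have Fle w : \1_F w <= expR a * \prod_(i <- J) f i (V i w).
  rewrite fE indicE; have [/[!inE] Fw|_] := boolP (w \in F); last first.
    exact: expR_ge0.
  by rewrite (le_trans _ (expR_ge1Dx _))// lerDl Fa.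
set M := \prod_(i <- J) _ in ap.
have EJ i : i \in J ->
    (\int[P]_w (f i (V i w))%:E = ((Num.sqrt (1 - 2 * t i * v i))^-1)%:E)%E.
  by move=> iJ; apply: sq_exp_moment; exact: tv.
split.
  rewrite -[F]setIT -integral_indic//.
  apply: (@le_trans _ _ (\int[P]_w ((expR a)%:E * (\prod_(i <- J) f i (V i
    w))%:E))%E).
    apply: ge0_le_integral => //.
    - by apply/measurable_EFinP; exact: measurable_indic.
    - by apply: measurable_funeM; exact/measurable_EFinP.
    - by move=> w _; rewrite -EFinM lee_fin.
  rewrite ge0_integralZl_EFin ?expR_ge0//.
  - rewrite (integral_prod_indep indV mV _ mf uJ EJ) -?EFinM ?lee_fin//.
    by move=> i y; exact: expR_ge0.
  - by move=> w _; rewrite lee_fin prodr_ge0// => i _; exact: expR_ge0.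
  - exact/measurable_EFinP.
move=> k kJ.
(* Equal to [f] on [J] and to the square at [k], so that the product rule applies to [k :: J]. *)
pose g i := if i == k then fun y : R => (c i * y) ^+ 2 else f i.
have mg i : measurable_fun setT (g i).
  rewrite /g; case: ifP => // _.
  by apply: measurable_funX; apply: measurable_funM.
have g0 i y : 0 <= g i y.
  by rewrite /g; case: ifP => _; rewrite ?sqr_ge0 ?expR_ge0.
have gJ w : \prod_(i <- k :: J) g i (V i w) = Q k w * \prod_(i <- J) f i (V i w).
  rewrite big_cons {1}/g eqxx; congr (_ * _).
  rewrite !big_seq; apply: eq_bigr => i iJ; rewrite /g; case: eqP => // ik.
  by move: kJ; rewrite -ik iJ.
pose m i := if i == k then fine (\int[P]_w (Q k w)%:E)%E
            else (Num.sqrt (1 - 2 * t i * v i))^-1.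
have Qfin : (\int[P]_w (Q k w)%:E)%E \is a fin_num.
  rewrite ge0_fin_numE ?(le_lt_trans (sq_moment_le k)) ?ltry//.
  by apply: integral_ge0 => w _; rewrite lee_fin sqr_ge0.
have EkJ i : i \in k :: J -> (\int[P]_w (g i (V i w))%:E = (m i)%:E)%E.
  rewrite inE /g /m; case: eqP => [-> _|_ /= iJ]; first by rewrite fineK.
  exact: EJ.
have ukJ : uniq (k :: J) by rewrite /= kJ.
have := integral_prod_indep indV mV g0 mg ukJ EkJ.
under eq_integral do rewrite gJ.
have -> : \prod_(i <- k :: J) m i = fine (\int[P]_w (Q k w)%:E)%E * M.
  rewrite big_cons {1}/m eqxx; congr (_ * _).
  rewrite /M !big_seq; apply: eq_bigr => i iJ; rewrite /m; case: eqP => // ik.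
  by move: kJ; rewrite -ik iJ.
move=> E.
apply: (@le_trans _ _ (\int[P]_w ((expR a)%:E *
    (Q k w * \prod_(i <- J) f i (V i w))%:E))%E).
  apply: ge0_le_integral => //.
  - by move=> w _; rewrite lee_fin mulr_ge0// sqr_ge0.
  - apply/measurable_EFinP; apply: measurable_funM; first exact: measurable_sq.
    exact: measurable_indic.
  - apply: measurable_funeM; apply/measurable_EFinP; apply: measurable_funM => //.
    exact: measurable_sq.
  - move=> w _; rewrite -EFinM lee_fin mulrCA ler_wpM2l// sqr_ge0//.
rewrite ge0_integralZl_EFin ?expR_ge0//.
- rewrite E -EFinM lee_fin mulrCA mulrC.
  have M0 : 0 <= expR a * M by rewrite mulr_ge0 ?expR_ge0// prodr_ge0// => i
    _; rewrite invr_ge0.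
  apply: ler_pM => //.
    by apply: fine_ge0; apply: integral_ge0 => w _; rewrite lee_fin sqr_ge0.
  by rewrite -lee_fin fineK//; exact: sq_moment_le.
- move=> w _; rewrite lee_fin mulr_ge0 ?sqr_ge0//.
  by rewrite prodr_ge0// => i _; exact: expR_ge0.
- apply/measurable_EFinP; apply: measurable_funM => //; exact: measurable_sq.
Qed.

End squared_gaussians.

(** * Power sums and truncation levels *)

Section power_sums.
Context {R : realType}.

Lemma powRDp (x r s : R) : 0 < x -> x `^ (r + s) = x `^ r * x `^ s.
Proof. by move=> x0; rewrite powRD// (gt_eqF x0) implybT. Qed.

Lemma le_powRN (x y a : R) : 0 < x -> x <= y -> 0 <= a -> y `^ (- a) <= x `^
  (- a).
Proof.
move=> x0 xy a0; have y0 := lt_le_trans x0 xy.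
rewrite !powRN lef_pV2 ?posrE ?powR_gt0//.
by apply: ge0_ler_powR; rewrite ?nnegrE// ltW.
Qed.

Lemma sum_powR_le (beta : R) (n : nat) : 0 <= beta ->
  \sum_(j < n) j.+1%:R `^ beta <= n%:R `^ (beta + 1).
Proof.
move=> b0; case: n => [|n]; first by rewrite big_ord0 powR_ge0.
rewrite powRDp// powRr1// mulr_natr.
rewrite -[X in _ *+ X]card_ord -sumr_const ler_sum// => j _.
by apply: ge0_ler_powR; rewrite ?nnegrE// ler_nat.
Qed.

(** Only the upper half of the indices is kept: at least n/2 terms, each at least (n/2)^beta. *)
Lemma sum_powR_ge (beta : R) (n : nat) : 0 <= beta ->
  (n%:R / 2) `^ (beta + 1) <= \sum_(j < n) j.+1%:R `^ beta.
Proof.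
move=> b0; case: n => [|n].
  rewrite big_ord0 mul0r powR0// gt_eqF// ltr_wpDl//.
set m := n.+1; have m0 : 0 < m%:R / 2 :> R by rewrite divr_gt0// ltr0n.
have half_le : (m./2)%:R <= m%:R / 2 :> R.
  rewrite ler_pdivlMr// -natrM ler_nat muln2 -{2}(odd_double_half m) leq_addl//.
have half_ge : m%:R / 2 <= (m./2.+1)%:R :> R.
  rewrite ler_pdivrMr// -natrM ler_nat muln2 -[X in (X <=
    _)%N](odd_double_half m) doubleS.
  by case: (odd m) => //=; lia.
rewrite powRDp// powRr1 ?(ltW m0)//.
rewrite -(big_mkord xpredT (fun j => j.+1%:R `^ beta)).
rewrite (big_cat_nat _ (n := m./2))//=; last first.
  by lia.
rewrite -[leLHS]add0r lerD//; first by apply: sumr_ge0 => j _; exact: powR_ge0.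
apply: (@le_trans _ _ (\sum_(m./2 <= j < m) (m%:R / 2) `^ beta)).
  rewrite sumr_const_nat -[leRHS]mulr_natr ler_wpM2l ?powR_ge0//.
  rewrite natrB; last by lia.
  lra.
apply: ler_sum_nat => j /andP[mj _].
apply: ge0_ler_powR; rewrite ?nnegrE ?(ltW m0)//.
by rewrite (le_trans half_ge)// ler_nat.
Qed.

(** Discrete form of the integral comparison: exp y >= 1 + y and ln(1 + y) <= y applied to the ratio
    n/(n+1). The right-hand side telescopes. *)
Lemma powR_step (g : R) (n : nat) : 0 < g -> (0 < n)%N ->
  n.+1%:R `^ (- g - 1) <= (n%:R `^ (- g) - n.+1%:R `^ (- g)) / g :> R.
Proof.
move=> g0 n0; rewrite ler_pdivlMr//.
have n0' : 0 < n%:R :> R by rewrite ltr0n.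
have n1' : 0 < n.+1%:R :> R by rewrite ltr0n.
have -> : n%:R = n.+1%:R * (n%:R / n.+1%:R) :> R by field; rewrite gt_eqF.
rewrite powRM ?divr_ge0 ?(ltW n0')//.
rewrite powRDp// -mulrA -{3}[_ `^ (- g)]mulr1 -mulrBr.
rewrite ler_wpM2l ?powR_ge0// powR_inv1 ?(ltW n1')//.
have q0 : 0 < n%:R / n.+1%:R :> R by rewrite divr_gt0.
rewrite lerBrDr {1}/powR gt_eqF// (le_trans _ (expR_ge1Dx _))// addrC lerD2l.
rewrite mulNr -mulrN mulrC ler_pM2l// lerNr.
have -> : n%:R / n.+1%:R = 1 + - n.+1%:R^-1 :> R.
  by rewrite -natr1; field; rewrite natr1 gt_eqF.
apply: le_ln1Dx; rewrite ltrN2 invf_lt1// ltr1n ltnS//.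
Qed.

Lemma nneseries_powR_le (g : R) (n : nat) : 0 < g -> (0 < n)%N ->
  (\sum_(n <= j <oo) (j.+1%:R `^ (- g - 1))%:E <= (n%:R `^ (- g) / g)%:E)%E.
Proof.
move=> g0 n0.
have partial m : (n <= m)%N -> \sum_(n <= j < m) j.+1%:R `^ (- g - 1) <=
    (n%:R `^ (- g) - m%:R `^ (- g)) / g :> R.
  elim: m => [|m ih]; first by rewrite leqn0 => /eqP n00; rewrite n00 in n0.
  rewrite leq_eqVlt => /predU1P[->|]; first by rewrite big_geq// subrr mul0r.
  rewrite ltnS => nm; rewrite big_nat_recr//=.
  have := ih nm; have := powR_step g0 (leq_trans n0 nm).
  rewrite !mulrBl; lra.
apply: lime_le.
  by apply: is_cvg_nneseries => j _ _; rewrite lee_fin powR_ge0.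
near=> m; have nm : (n <= m)%N by near: m; exact: nbhs_infty_ge.
rewrite sumEFin lee_fin (le_trans (partial m nm))//.
by rewrite ler_pM2r ?invr_gt0// gerBl powR_ge0.
Unshelve. all: by end_near. Qed.

(** The n terms with n <= j < 2n are each at least (2n)^(-g-1). *)
Lemma nneseries_powR_ge (g : R) (n : nat) : 0 < g -> (0 < n)%N ->
  ((2 `^ (- g - 1) * n%:R `^ (- g))%:E <= \sum_(n <= j <oo) (j.+1%:R `^ (- g -
    1))%:E)%E.
Proof.
move=> g0 n0; rewrite (@nneseries_split _ _ n n); last first.
  by move=> j _; rewrite lee_fin powR_ge0.
rewrite -[leLHS]adde0 leeD//; last first.
  by apply: nneseries_ge0 => j _ _; rewrite lee_fin powR_ge0.
rewrite sumEFin lee_fin.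
have n0' : 0 < n%:R :> R by rewrite ltr0n.
apply: (@le_trans _ _ (\sum_(n <= j < n + n) (2 * n%:R) `^ (- g - 1))).
  rewrite sumr_const_nat addnK powRM// -[leRHS]mulr_natr -mulrA ler_wpM2l
    ?powR_ge0//.
  rewrite (@powRDp _ (- g))// powR_inv1 ?(ltW n0')//.
  by rewrite -mulrA mulVf ?mulr1// gt_eqF.
apply: ler_sum_nat => j /andP[_ jn].
have -> : - g - 1 = - (g + 1) by ring.
apply: le_powRN => //.
- by rewrite -natrM ler_nat mul2n -addnn.
- by rewrite addr_ge0// ltW.
Qed.

End power_sums.

(** * Number of kept coefficients and length of the blocks *)

Section truncation_levels.
Context {R : realType}.
Variables (omega0 omega : R).
Hypotheses (omega0_gt1 : 1 < omega0) (omega_gt1 : 1 < omega).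

Definition tdim n := (trunc_level omega0 omega n).-1.

Let om_ge1 n : 1 <= omega ^+ n.
Proof. by rewrite exprn_ege1// ltW. Qed.

Let oo_gt1 n : 1 < omega0 * omega ^+ n.
Proof.
by rewrite (lt_le_trans omega0_gt1)// ler_peMr// ltW// (lt_trans _ omega0_gt1).
Qed.

Lemma trunc_level_gt1 n : (1 < trunc_level omega0 omega n)%N.
Proof.
rewrite /trunc_level.
have : (1 < Num.ceil (omega0 * omega ^+ n))%R by rewrite ceil_gt_int oo_gt1.
by case: (Num.ceil _).
Qed.

Lemma tdimS n : (tdim n).+1%:R = (Num.ceil (omega0 * omega ^+ n))%:~R :> R.
Proof.
rewrite /tdim prednK ?(ltnW (trunc_level_gt1 n))// /trunc_level.
rewrite -[LHS]/((Posz _)%:~R) gez0_abs//.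
by rewrite ceil_ge0 (lt_trans _ (oo_gt1 n)).
Qed.

Lemma tdim_gt0 n : (0 < tdim n)%N.
Proof. by rewrite /tdim -ltnS prednK ?(ltnW (trunc_level_gt1 n))//
  trunc_level_gt1. Qed.

Lemma tdim_lt n : (tdim n)%:R < omega0 * omega ^+ n :> R.
Proof.
have := ceilB1_lt (omega0 * omega ^+ n).
by rewrite intrD -tdimS -natr1 addrK.
Qed.

Lemma le_tdimS n : omega0 * omega ^+ n <= (tdim n).+1%:R :> R.
Proof. by rewrite tdimS ceil_ge. Qed.

Lemma le_tdim2 n : omega0 * omega ^+ n <= 2 * (tdim n)%:R :> R.
Proof.
rewrite (le_trans (le_tdimS n))// -natrM ler_nat mul2n -addnn.
by rewrite -addn1 leq_add2l tdim_gt0.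
Qed.

Lemma tdim_leS n : (tdim n <= tdim n.+1)%N.
Proof.
rewrite -ltnS -(ltr_nat R); apply: (lt_le_trans (tdim_lt n)).
apply: le_trans (le_tdimS n.+1).
by rewrite ler_pM2l ?(lt_trans _ omega0_gt1)// exprS ler_peMl ?(ltW
  omega_gt1)// (le_trans _ (om_ge1 n)).
Qed.

Lemma tdim_le m n : (m <= n)%N -> (tdim m <= tdim n)%N.
Proof.
elim: n => [|n ih]; first by rewrite leqn0 => /eqP->.
by rewrite leq_eqVlt => /predU1P[->//|/ih/leq_trans]; apply; exact: tdim_leS.
Qed.

(** Consecutive values of omega0 omega^n differ by at least 2, which absorbs the rounding.
    [trunc_large] derives this from the condition on c3 / c6. *)
Hypothesis omega0_large : 2 <= omega0 * (omega - 1).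

(** Rounding costs at most 1 of the gap omega0 omega^n (omega - 1); the gap being at least 2, half
    of it survives. *)
Lemma tdim_block n :
  omega0 * omega ^+ n * (omega - 1) / 2 <= (tdim n.+1)%:R - (tdim n)%:R :> R.
Proof.
have := tdim_lt n; have := le_tdimS n.+1; rewrite exprS -natr1.
have : 2 <= omega0 * omega ^+ n * (omega - 1).
  by rewrite mulrAC (le_trans omega0_large)// ler_peMr// (le_trans _
    omega0_large).
set a := omega0; set b := omega ^+ n; set c := omega; nra.
Qed.

Lemma tdim_block_ge2 n : (tdim n + 2 <= tdim n.+1)%N.
Proof.
have : (tdim n)%:R + 1 < (tdim n.+1)%:R :> R.
  have := tdim_lt n; have := le_tdimS n.+1; rewrite exprS -natr1.
  have : 2 <= omega0 * omega ^+ n * (omega - 1).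
    by rewrite mulrAC (le_trans omega0_large)// ler_peMr// (le_trans _
      omega0_large).
  set a := omega0; set b := omega ^+ n; set c := omega; nra.
by rewrite natr1 ltr_nat addn2.
Qed.

(** The dimension is below omega0 omega^(n+1), of which the last block is a fixed fraction by
    [tdim_block]. This ratio becomes [cD] in [small_block_bound]. *)
Lemma tdim_le_block n :
  (tdim n.+1)%:R <= 2 * omega / (omega - 1) * (tdim n.+1 - tdim n)%:R :> R.
Proof.
have om1 : 0 < omega - 1 by rewrite subr_gt0.
rewrite natrB ?tdim_leS// mulrAC ler_pdivlMr//.
have := tdim_block n; have := tdim_lt n.+1; rewrite exprS => h1 h2.
have : (tdim n.+1)%:R * (omega - 1) <= omega * (omega0 * omega ^+ n * (omega -
  1)).
  by rewrite mulrA ler_pM2r// (le_trans (ltW h1))// mulrCA.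
move/le_trans; apply; rewrite (mulrC 2) -[leRHS]mulrA ler_pM2l ?(lt_trans _
  omega_gt1)//.
lra.
Qed.

End truncation_levels.

(* With p = 1 - 1/omega0 and y = p^b, the hypothesis gives
   omega^(-b) <= 1 - 1/(2y), while omega < 1 + 2/omega0 <= p^(-2) would give
   omega^(-b) >= y^2, contradicting y (1 - y^2) < 1/2. *)
Lemma trunc_large (R : realType) (gamma lambda eps omega0 omega : R) :
  1 / 2 < gamma -> 0 < 2 * lambda + 2 * eps -> 1 < omega0 -> 1 < omega ->
  1 / 2 <= c3 lambda eps omega0 omega / c6 gamma lambda eps omega0 ->
  2 <= omega0 * (omega - 1).
Proof.
move=> gamma12 eps0 O1 om1; rewrite /c3 /c6.
set b := 2 * lambda + 2 * eps + 1; set g := 2 * gamma - 1.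
have -> : - 2 * lambda - 2 * eps - 1 = - b by rewrite /b; ring.
have -> : - 2 * gamma + 1 = - g by rewrite /g; ring.
have b0 : 0 < b by rewrite /b; lra.
have g0 : 0 < g by rewrite /g; lra.
have O0 : 0 < omega0 by lra.
have om0 : 0 < omega by lra.
set p := (omega0 - 1) / omega0; set c := Num.max _ _.
have p0 : 0 < p by rewrite divr_gt0// subr_gt0.
have p1 : p <= 1 by rewrite ler_pdivrMr// mul1r gerBl.
have cg : p `^ (- g) <= c by rewrite /c le_max lexx.
have c_ge1 : 1 <= c.
  apply: le_trans cg; rewrite -[leLHS](_ : 1 `^ (- g) = 1); last by rewrite powR1.
  by apply: le_powRN => //; exact: ltW.
have c0 : 0 < c by rewrite (lt_le_trans _ c_ge1).
rewrite ler_pdivlMr// => H; rewrite leNgt; apply/negP => H2.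
have omp : omega <= p `^ (- 2).
  have -> : p `^ (- 2) = (p ^+ 2)^-1 by rewrite powRN -powR_mulrn// ltW.
  rewrite -[leRHS]mul1r ler_pdivlMr ?exprn_gt0//.
  set r := omega0^-1; have r0 : 0 < r by rewrite invr_gt0.
  have r1 : r <= 1 by rewrite invf_le1// ltW.
  have -> : p = 1 - r by rewrite /p /r; field; rewrite gt_eqF.
  have h : omega <= 1 + 2 * r.
    rewrite -lerBlDl ler_pdivlMr//; lra.
  apply: (@le_trans _ _ ((1 + 2 * r) * (1 - r) ^+ 2)).
    by rewrite ler_wpM2r ?sqr_ge0.
  have : 0 <= r ^+ 2 * (3 - 2 * r) by rewrite mulr_ge0 ?sqr_ge0//; lra.
  by rewrite !expr2; nra.
have om_y : (p `^ b) ^+ 2 <= omega `^ (- b).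
  have -> : (p `^ b) ^+ 2 = (p `^ (- 2)) `^ (- b).
    by rewrite -(powRrM p (- 2)) mulrNN mulrC (powRrM p b) (powR_mulrn 2
      (powR_ge0 p b)).
  by apply: le_powRN => //; exact: ltW.
have y0 : 0 < p `^ b by rewrite powR_gt0.
move: om_y H y0; set y := p `^ b; set W := omega `^ _ => om_y H y0.
have : 1 / 2 <= y * (1 - y ^+ 2) by nra.
(* Expands to y^3 - (27/25) y + 54/125 >= 0, whence y - y^3 < 1/2; 3/5 is close to the maximiser
   1/sqrt 3. *)
have : 0 <= (y - 3 / 5) ^+ 2 * (y + 6 / 5).
  by rewrite mulr_ge0 ?sqr_ge0//; lra.
rewrite !expr2 => h1 h2; nra.
Qed.

(** * Exponential bounds for one block of coefficients *)

Section block_events.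
Context {R : realType} {d : measure_display} {T : measurableType d}.
Variable P : probability T R.
Variables (V : nat + nat -> T -> R) (s c : nat + nat -> R).
Hypothesis s_gt0 : forall i, 0 < s i.
Hypothesis c_gt0 : forall i, 0 < c i.
Hypothesis lawV : forall i, normal_law P (V i) 0 (s i).
Hypothesis indV : mutually_independent P V.
Variables (eta delta g beta : R).
Hypotheses (eta_gt0 : 0 < eta) (delta_gt0 : 0 < delta) (g_gt0 : 0 < g)
  (beta_ge0 : 0 <= beta).
Hypothesis varX : forall j,
  (c (inl j) * s (inl j)) ^+ 2 = eta ^+ 2 * j.+1%:R `^ (- g - 1).
Hypothesis varZ : forall j,
  (c (inr j) * s (inr j)) ^+ 2 = delta ^+ 2 * j.+1%:R `^ beta.

Let Q i w := (c i * V i w) ^+ 2.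

Definition block (m n : nat) : seq (nat + nat) :=
  [seq inl j | j <- index_iota m n] ++ [seq inr j | j <- index_iota m n].

Lemma block_uniq m n : uniq (block m n).
Proof.
rewrite cat_uniq !map_inj_uniq ?iota_uniq//=; last 2 first.
- by move=> x y [].
- by move=> x y [].
by rewrite andbT; apply/hasPn => _ /mapP[j _ ->]; apply/mapP => -[].
Qed.

Lemma mem_block_inl m n j : (inl j \in block m n) = (m <= j < n)%N.
Proof.
rewrite mem_cat -mem_index_iota; apply/orP/idP.
  by case=> /mapP[k kmn]// [->].
by move=> jmn; left; apply/mapP; exists j.
Qed.

Lemma mem_block_inr m n j : (inr j \in block m n) = (m <= j < n)%N.
Proof.
rewrite mem_cat -mem_index_iota; apply/orP/idP.
  by case=> /mapP[k kmn]// [->].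
by move=> jmn; right; apply/mapP; exists j.
Qed.

Lemma block_prod (F : nat + nat -> R) m n : \prod_(i <- block m n) F i =
  \prod_(m <= j < n) (F (inl j) * F (inr j)).
Proof. by rewrite big_cat !big_map big_split. Qed.

Lemma block_sum (F : nat + nat -> R) m n : \sum_(i <- block m n) F i =
  \sum_(m <= j < n) F (inl j) + \sum_(m <= j < n) F (inr j).
Proof. by rewrite big_cat !big_map. Qed.

(** On [F] the bias of the block is dominated by noise, which is unlikely; a later bias coefficient
    is independent of the block and keeps this small factor. The factor is (K rho)^2, with rho^2 the
    variance ratio of noise to bias at index [n]. *)
Lemma small_block_bound (tau cD r : R) (m n : nat) (F : set T) :
  (0 < m)%N -> (m + 2 <= n)%N -> n%:R <= cD * (n - m)%:R -> 0 <= r ->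
  r <= 6 * (delta ^+ 2 * n%:R `^ (beta + 1)) -> measurable F ->
  (forall w, F w -> \sum_(m <= j < n) Q (inl j) w <=
     32 * tau ^+ 2 * r + 2 * \sum_(m <= j < n) Q (inr j) w) ->
  forall k, (n <= k)%N -> (\int[P]_w (Q (inl k) w * \1_F w)%:E <=
    ((4 * expR (24 * tau ^+ 2 * cD)) ^+ 2 * (delta ^+ 2 / eta ^+ 2) *
      n%:R `^ (beta + g + 1) * (6 * (eta ^+ 2 * k.+1%:R `^ (- g - 1))))%:E)%E.
Proof.
move=> m0 mn ncD r0 rle mF FX k nk.
have n0 : 0 < n%:R :> R by rewrite ltr0n (leq_trans _ mn)// ?addnS.
pose z := delta ^+ 2 * n%:R `^ beta.
pose v0 := eta ^+ 2 * n%:R `^ (- g - 1).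
have z0 : 0 < z by rewrite mulr_gt0 ?exprn_gt0 ?powR_gt0.
have v00 : 0 < v0 by rewrite mulr_gt0 ?exprn_gt0 ?powR_gt0.
(* Chernoff with weights - sg on the bias and 2 sg on the noise: each index of
   the block contributes a factor at most K rho, and there are at least two. *)
pose sg := (8 * z)^-1; have sg0 : 0 < sg by rewrite invr_gt0 mulr_gt0.
pose rho := Num.sqrt (z / v0).
have rho0 : 0 < rho by rewrite sqrtr_gt0 divr_gt0.
have rho2 : rho ^+ 2 = z / v0 by rewrite sqr_sqrtr// ltW// divr_gt0.
set K := 4 * _.
have K0 : 0 < K by rewrite mulr_gt0// expR_gt0.
have -> : K ^+ 2 * (delta ^+ 2 / eta ^+ 2) * n%:R `^ (beta + g + 1) =
    (K * rho) ^+ 2.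
  rewrite [RHS]exprMn rho2 -mulrA; congr (_ * _); rewrite /z /v0.
  have -> : n%:R `^ (beta + g + 1) = n%:R `^ beta / n%:R `^ (- g - 1) :> R.
    by rewrite -powRN -powRDp//; congr (_ `^ _); ring.
  field; rewrite !gt_eqF ?powR_gt0//.
(* For K rho > 1 the claimed factor exceeds 1 and the plain moment bound suffices. For K rho <= 1
   the power n - m of the Chernoff bound may be lowered to 2. *)
have [Kr1|Kr1] := leP (K * rho) 1; last first.
  apply: (@le_trans _ _ (\int[P]_w (Q (inl k) w)%:E)%E).
    apply: ge0_le_integral => //.
    - by move=> w _; rewrite lee_fin mulr_ge0// sqr_ge0.
    - apply/measurable_EFinP; apply: measurable_funM;
      last exact: measurable_indic.
      exact: (measurable_sq c lawV).
    - by apply/measurable_EFinP; exact: (measurable_sq c lawV).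
    - by move=> w _; rewrite lee_fin ler_piMr ?sqr_ge0// indicE; case: (_ \in _).
  apply: le_trans (sq_moment_le s_gt0 c_gt0 lawV (inl k)) _.
  rewrite lee_fin varX ler_peMl//.
    by rewrite mulr_ge0// mulr_ge0 ?sqr_ge0 ?powR_ge0.
  by rewrite exprn_ege1// ltW.
pose t (i : nat + nat) := if i is inl _ then - sg else 2 * sg.
have vZ j : (j < n)%N -> (c (inr j) * s (inr j)) ^+ 2 <= z.
  move=> jn; rewrite varZ ler_wpM2l ?sqr_ge0//.
  by apply: ge0_ler_powR; rewrite ?nnegrE// ler_nat.
have vX j : (j < n)%N -> v0 <= (c (inl j) * s (inl j)) ^+ 2.
  move=> jn; rewrite varX ler_wpM2l ?sqr_ge0//.
  rewrite -opprD; apply: le_powRN; rewrite ?ltr0n ?ler_nat//.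
  by rewrite addr_ge0// ltW.
have sz : sg * z = 8^-1 by rewrite /sg; field; rewrite gt_eqF.
have half j : (j < n)%N -> 1 / 2 <= 1 - 2 * (2 * sg) * (c (inr j) * s (inr j))
  ^+ 2.
  by move=> /vZ jz; have := ler_wpM2l (ltW sg0) jz; rewrite sz; lra.
have := sq_chernoff (t := t) (a := 32 * tau ^+ 2 * r * sg) (p := (K * rho) ^+ 2)
  s_gt0 c_gt0 lawV indV (block_uniq m n) _ mF.
case=> [|||_ H].
- move=> [j|j]; rewrite ?mem_block_inl ?mem_block_inr => /andP[_ jn] /=.
    have : 0 < sg * (c (inl j) * s (inl j)) ^+ 2.
      by rewrite mulr_gt0// exprn_gt0// mulr_gt0.
    lra.
  by have := half _ jn; lra.
- move=> w /FX FX'; rewrite block_sum /= -!mulr_sumr.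
  have := ler_wpM2r (ltW sg0) FX'; lra.
- rewrite block_prod /=.
  apply: (@le_trans _ _ (expR (24 * tau ^+ 2 * cD * (n - m)%:R) *
      \prod_(m <= j < n) (4 * rho))).
    apply: ler_pM; rewrite ?expR_ge0//.
    + by apply: prodr_ge0 => j _; rewrite mulr_ge0// invr_ge0.
    (* As r sg <= (6/8) n, the exponent is at most 24 tau^2 n, and n <= cD (n - m) spreads it over
       the n - m factors. *)
    + rewrite ler_expR.
      apply: (@le_trans _ _ (24 * tau ^+ 2 * n%:R)); last first.
        by rewrite -[leRHS]mulrA ler_wpM2l// mulr_ge0// sqr_ge0.
      have : r * sg <= 6 / 8 * n%:R.
        rewrite -ler_pdivlMr// invrK; apply: (le_trans rle); rewrite /z.
        by rewrite powRDp// powRr1 ?(ltW n0)//; lra.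
      move=> h; have := ler_wpM2l (sqr_ge0 tau) h; lra.
    (* The bias coordinate gives at most 2 rho, since 1 + 2 sg v >= 2 sg v0 = (2 rho)^(-2); the
       noise coordinate gives at most 2, since 1 - 4 sg z = 1/2. *)
    rewrite big_nat [leRHS]big_nat ler_prod// => j /andP[_ jn].
    rewrite mulr_ge0 ?invr_ge0//= (_ : 4 * rho = (2 * rho) * 2); last by ring.
    apply: ler_pM; rewrite ?invr_ge0//.
      rewrite -[leRHS]invrK lef_pV2 ?posrE ?invr_gt0 ?mulr_gt0 ?sqrtr_gt0
        ?divr_gt0//; last first.
        have : 0 < sg * (c (inl j) * s (inl j)) ^+ 2.
          by rewrite mulr_gt0// exprn_gt0// mulr_gt0.
        lra.
      rewrite -(@ler_pXn2r _ 2) ?nnegrE ?invr_ge0 ?mulr_ge0 ?(ltW rho0)//.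
      have vjX := vX _ jn.
      have h : 0 < sg * (c (inl j) * s (inl j)) ^+ 2.
        by rewrite mulr_gt0// exprn_gt0// mulr_gt0.
      rewrite sqr_sqrtr; last by lra.
      rewrite exprVn exprMn rho2.
      have -> : (2 ^+ 2 * (z / v0))^-1 = 2 * sg * v0.
        by rewrite /sg; field; rewrite !gt_eqF.
      have := ler_wpM2l (ltW sg0) vjX; lra.
    rewrite -[leRHS]invrK lef_pV2 ?posrE ?invr_gt0 ?sqrtr_gt0//; last first.
      by have := half _ jn; lra.
    rewrite -(@ler_pXn2r _ 2) ?nnegrE ?invr_ge0//.
    have := half _ jn => hj; rewrite sqr_sqrtr; last by lra.
    by rewrite exprVn; lra.
  rewrite prodr_const_nat mulrC expRM_natr mulrC -exprMn.
  have -> : expR (24 * tau ^+ 2 * cD) * (4 * rho) = K * rho by rewrite /K; ring.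
  apply: ler_wiXn2l; rewrite ?mulr_ge0 ?(ltW K0) ?(ltW rho0)//.
  by rewrite leq_subRL// (leq_trans (leq_addr 2 m)).
- by rewrite -varX; apply: H; rewrite mem_block_inl ltnNge nk andbF.
Qed.

(** From (1 - y) exp(2 y) >= (1 - y)(1 + 2 y) >= 1 on this range. *)
Let sqrt_le (y : R) : 0 <= y -> y <= 1 / 2 -> (Num.sqrt (1 - y))^-1 <= expR y.
Proof.
move=> y0 y1; have h : 0 < 1 - y by lra.
rewrite -[leRHS]invrK lef_pV2 ?posrE ?invr_gt0 ?sqrtr_gt0 ?expR_gt0//.
rewrite -(@ler_pXn2r _ 2) ?nnegrE ?invr_ge0 ?expR_ge0// sqr_sqrtr ?(ltW h)//.
rewrite exprVn -expRM_natr -[leLHS]mul1r ler_pdivrMr ?expR_gt0//.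
apply: (@le_trans _ _ ((1 - y) * (1 + y * 2))); first by nra.
by rewrite ler_wpM2l ?(ltW h)// expR_ge1Dx.
Qed.

(** Chernoff with one weight [sg] on all squares of the block. Each index contributes at most exp(3
    sg v), with v its noise variance, so in all exp(6 sg r) against the threshold exp(- 8 sg r). The
    remaining 2 sg r is at least of order [n], because sg z = 1/4. *)
Lemma large_block_bound (r : R) (m n : nat) (F : set T) :
  (0 < m)%N -> (m < n)%N ->
  2 * (eta ^+ 2 * m%:R `^ (- g - 1)) <= delta ^+ 2 * m%:R `^ beta ->
  delta ^+ 2 * (\sum_(j < n) j.+1%:R `^ beta) <= 2 * r -> measurable F ->
  (forall w, F w -> 8 * r <=
    \sum_(m <= j < n) Q (inl j) w + \sum_(m <= j < n) Q (inr j) w) ->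
  let q := expR (- (n%:R / (4 * 2 `^ (beta + 1)))) in
  (P F <= q%:E)%E /\
  forall k, ~~ (m <= k < n)%N -> (\int[P]_w (Q (inr k) w * \1_F w)%:E <=
    (q * (6 * (delta ^+ 2 * k.+1%:R `^ beta)))%:E)%E.
Proof.
move=> m0 mn cond rge mF FX q.
have n0 : 0 < n%:R :> R by rewrite ltr0n (leq_trans m0)// ltnW.
have m0' : 0 < m%:R :> R by rewrite ltr0n.
pose z := delta ^+ 2 * n%:R `^ beta.
have z0 : 0 < z by rewrite mulr_gt0 ?exprn_gt0 ?powR_gt0.
pose sg := (4 * z)^-1; have sg0 : 0 < sg by rewrite invr_gt0 mulr_gt0.
have sz : sg * z = 4^-1 by rewrite /sg; field; rewrite gt_eqF.
have vZ j : (j < n)%N -> (c (inr j) * s (inr j)) ^+ 2 <= z.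
  move=> jn; rewrite varZ ler_wpM2l ?sqr_ge0//.
  by apply: ge0_ler_powR; rewrite ?nnegrE// ler_nat.
(* Bias variances decrease and noise variances increase with the index, so [cond] at [m] extends to
   the whole block. *)
have vXZ j : (m <= j)%N ->
    2 * (c (inl j) * s (inl j)) ^+ 2 <= (c (inr j) * s (inr j)) ^+ 2.
  move=> mj; rewrite varX varZ.
  apply: (@le_trans _ _ (2 * (eta ^+ 2 * m%:R `^ (- g - 1)))).
    rewrite ler_wpM2l// ler_wpM2l ?sqr_ge0// -opprD.
    by apply: le_powRN; rewrite ?ler_nat ?(leq_trans mj)// addr_ge0// ltW.
  apply: (le_trans cond); rewrite ler_wpM2l ?sqr_ge0//.
  by apply: ge0_ler_powR; rewrite ?nnegrE// ler_nat (leq_trans mj).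
have v_gt0 i : 0 < (c i * s i) ^+ 2 by rewrite exprn_gt0// mulr_gt0.
have := sq_chernoff (t := fun=> sg) (a := - (8 * r * sg)) (p := q)
  s_gt0 c_gt0 lawV indV (block_uniq m n) _ mF.
case=> [|||PF H].
- move=> [j|j]; rewrite ?mem_block_inl ?mem_block_inr => /andP[mj jn] /=.
    have := ler_wpM2l (ltW sg0) (vXZ _ mj).
    have := ler_wpM2l (ltW sg0) (vZ _ jn); rewrite sz; lra.
  have := ler_wpM2l (ltW sg0) (vZ _ jn); rewrite sz; lra.
- move=> w /FX FX'; rewrite block_sum /= -!mulr_sumr.
  have := ler_wpM2r (ltW sg0) FX'; lra.
- pose vz j := (c (inr j) * s (inr j)) ^+ 2.
  rewrite block_prod /=.
  apply: (@le_trans _ _ (expR (- (8 * r * sg)) *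
      \prod_(m <= j < n) expR (3 * sg * vz j))).
    rewrite ler_wpM2l ?expR_ge0//.
    rewrite big_nat [leRHS]big_nat ler_prod// => j /andP[mj jn].
    rewrite mulr_ge0 ?invr_ge0//=.
    have hz := ler_wpM2l (ltW sg0) (vZ _ jn); rewrite sz in hz.
    have hx := ler_wpM2l (ltW sg0) (vXZ _ mj).
    have pz := mulr_gt0 sg0 (v_gt0 (inr j)).
    have px := mulr_gt0 sg0 (v_gt0 (inl j)).
    apply: (@le_trans _ _ (expR (2 * sg * (c (inl j) * s (inl j)) ^+ 2) *
        expR (2 * sg * (c (inr j) * s (inr j)) ^+ 2))).
      by apply: ler_pM; rewrite ?invr_ge0//; apply: sqrt_le; lra.
    by rewrite -expRD ler_expR /vz; lra.
  rewrite -expR_sum -expRD ler_expR -mulr_sumr.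
  have sumle : \sum_(m <= j < n) vz j <= 2 * r.
    apply: le_trans rge; rewrite mulr_sumr.
    rewrite -(big_mkord xpredT (fun j => delta ^+ 2 * j.+1%:R `^ beta)).
    rewrite [leRHS](big_cat_nat _ (n := m))//= ?(ltnW mn)// -[leLHS]add0r lerD//.
      by apply: sumr_ge0 => j _; rewrite mulr_ge0 ?sqr_ge0 ?powR_ge0.
    by apply: ler_sum_nat => j _; rewrite /vz varZ.
  have h1 := ler_wpM2l (ltW sg0) sumle.
  have h2 : n%:R / (4 * 2 `^ (beta + 1)) <= 2 * (sg * r).
    have := le_trans (ler_wpM2l (sqr_ge0 delta) (sum_powR_ge n beta_ge0)) rge.
    move=> /(ler_wpM2l (ltW sg0)).
    rewrite powRM// -powR_inv1// -powRrM mulN1r powRN (powRDp _ _ n0) powRr1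
      ?(ltW n0)//.
    move=> h; rewrite mulrCA; apply: le_trans h.
    rewrite le_eqVlt; apply/orP; left; apply/eqP; rewrite /sg /z.
    by field; rewrite !gt_eqF ?powR_gt0.
  lra.
- by split=> // k km; rewrite -varZ; apply: H; rewrite mem_block_inr.
Qed.

End block_events.

Lemma bernoulli_archi (R : realType) (a B : R) : 1 < a -> exists n, B <= a ^+ n.
Proof.
move=> a1; have a10 : 0 < a - 1 by rewrite subr_gt0.
have bern n : 1 + n%:R * (a - 1) <= a ^+ n.
  elim: n => [|n ih]; first by rewrite mul0r addr0 expr0.
  have : 0 <= n%:R * (a - 1) ^+ 2 by rewrite mulr_ge0// sqr_ge0.
  have a0 : 0 <= a by lra.
  by have := ler_wpM2l a0 ih; rewrite (exprS a n) -natr1 expr2; lra.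
exists (Num.bound `|B / (a - 1)|); apply: le_trans (bern _).
have := archi_boundP (normr_ge0 (B / (a - 1))).
move=> /(le_lt_trans (ler_norm _)); rewrite ltr_pdivrMr//; lra.
Qed.

(** * Scaling around the optimal parameter *)

Section scales.
Context {R : realType}.
Variables (omega0 omega : R).
Hypotheses (omega0_gt1 : 1 < omega0) (omega_gt1 : 1 < omega).
Variables (eta delta g b U nopt : R).
Hypotheses (g_gt0 : 0 < g) (b_gt0 : 0 < b) (U_gt0 : 0 < U).
(** The equation of n_opt with common value [U], solved for eta^2 and delta^2. All bounds become
    multiples of [U], with constants free of eta and delta. *)
Hypothesis etaE : eta ^+ 2 = U * g * omega0 `^ g * omega `^ (g * nopt).
Hypothesis deltaE : delta ^+ 2 = U * b * omega0 `^ (- b) * omega `^ (- b * nopt).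

Local Notation D n := ((tdim omega0 omega n)%:R : R).

Let O0 : 0 < omega0. Proof. exact: lt_trans omega0_gt1. Qed.
Let om0 : 0 < omega. Proof. exact: lt_trans omega_gt1. Qed.
Let D0 n : 0 < D n. Proof. by rewrite ltr0n tdim_gt0. Qed.

Let oo_powR n a : (omega0 * omega ^+ n) `^ a = omega0 `^ a * omega `^ (a * n%:R).
Proof.
rewrite powRM ?exprn_ge0 ?(ltW O0) ?(ltW om0)//.
by rewrite -powR_mulrn ?(ltW om0)// -powRrM (mulrC n%:R).
Qed.

Lemma variance_scale_le n :
  delta ^+ 2 * D n `^ b <= b * U * omega `^ (b * (n%:R - nopt)).
Proof.
have : D n `^ b <= (omega0 * omega ^+ n) `^ b.
  apply: ge0_ler_powR; rewrite ?nnegrE ?(ltW b_gt0) ?(ltW (D0 n))//.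
    by rewrite mulr_ge0 ?exprn_ge0 ?(ltW O0) ?(ltW om0).
  by rewrite ltW// tdim_lt.
move/(ler_wpM2l (sqr_ge0 delta))/le_trans; apply.
rewrite oo_powR deltaE mulrBr (powRDp _ _ om0) (powRN _ b) -mulNr.
rewrite le_eqVlt; apply/orP; left; apply/eqP.
by field; rewrite gt_eqF ?powR_gt0.
Qed.

Lemma variance_scale_ge n :
  4 `^ (- b) * b * U * omega `^ (b * (n%:R - nopt)) <= delta ^+ 2 * (D n / 2)
    `^ b.
Proof.
have : (4^-1 * (omega0 * omega ^+ n)) `^ b <= (D n / 2) `^ b.
  apply: ge0_ler_powR; rewrite ?nnegrE ?(ltW b_gt0)//.
  - by rewrite !mulr_ge0 ?invr_ge0 ?exprn_ge0 ?(ltW O0) ?(ltW om0).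
  - have := le_tdim2 omega0_gt1 omega_gt1 n; lra.
move/(ler_wpM2l (sqr_ge0 delta)); apply: le_trans.
have oo0 : 0 <= omega0 * omega ^+ n.
  by rewrite mulr_ge0 ?exprn_ge0 ?(ltW O0) ?(ltW om0).
rewrite powRM ?invr_ge0// oo_powR deltaE mulrBr (powRDp _ _ om0) (powRN
  omega0) -mulNr.
rewrite -(powR_inv1 (a := 4))// -powRrM mulN1r.
rewrite le_eqVlt; apply/orP; left; apply/eqP.
by field; rewrite gt_eqF ?powR_gt0.
Qed.

Lemma bias_scale_le n :
  eta ^+ 2 * (D n `^ (- g) / g) <= 2 `^ g * U * omega `^ (- g * (n%:R - nopt)).
Proof.
have : D n `^ (- g) <= (2^-1 * (omega0 * omega ^+ n)) `^ (- g).
  apply: le_powRN; rewrite ?(ltW g_gt0)//.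
    by rewrite !mulr_gt0 ?invr_gt0 ?exprn_gt0.
  by have := le_tdim2 omega0_gt1 omega_gt1 n; lra.
have gi : 0 <= g^-1 by rewrite invr_ge0 ltW.
move/(ler_wpM2r gi)/(ler_wpM2l (sqr_ge0 eta))/le_trans; apply.
have oo0 : 0 <= omega0 * omega ^+ n.
  by rewrite mulr_ge0 ?exprn_ge0 ?(ltW O0) ?(ltW om0).
rewrite powRM ?invr_ge0// oo_powR etaE mulrBr (powRDp _ _ om0) (powRN omega0)
  !mulNr opprK.
rewrite -(powR_inv1 (a := 2))// -powRrM mulrNN mul1r.
rewrite le_eqVlt; apply/orP; left; apply/eqP.
by field; rewrite !gt_eqF ?powR_gt0.
Qed.

Lemma bias_scale_ge n :
  2 `^ (- g - 1) * g * U * omega `^ (- g * (n%:R - nopt)) <=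
  eta ^+ 2 * (2 `^ (- g - 1) * D n `^ (- g)).
Proof.
have : (omega0 * omega ^+ n) `^ (- g) <= D n `^ (- g).
  apply: le_powRN; rewrite ?(ltW g_gt0)// ltW// tdim_lt//.
move/(ler_wpM2l (powR_ge0 2 (- g - 1)))/(ler_wpM2l (sqr_ge0 eta));
  apply: le_trans.
rewrite oo_powR etaE mulrBr (powRDp _ _ om0) (powRN omega0) !mulNr opprK.
rewrite le_eqVlt; apply/orP; left; apply/eqP.
by field; rewrite !gt_eqF ?powR_gt0.
Qed.

(** The ratio of noise to bias variance grows like omega^((g + b)(n - nopt)), so a fixed margin of
    [M] levels above n_opt beats any constant. This puts [large_block_bound] at disposal. *)
Lemma bias_le_variance (M n : nat) :
  2 `^ (g + b + 1) * g / b <= (omega `^ (g + b)) ^+ M -> nopt + M%:R <= n%:R ->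
  2 * (eta ^+ 2 * D n `^ (- g - 1)) <= delta ^+ 2 * D n `^ (b - 1).
Proof.
move=> HM nM.
have h : (2^-1 * (omega0 * omega ^+ n)) `^ (g + b) <= D n `^ (g + b).
  apply: ge0_ler_powR; rewrite ?nnegrE ?addr_ge0 ?(ltW g_gt0) ?(ltW b_gt0)
    ?(ltW (D0 n))//.
    by rewrite !mulr_ge0 ?invr_ge0 ?exprn_ge0 ?(ltW O0) ?(ltW om0).
  by have := le_tdim2 omega0_gt1 omega_gt1 n; lra.
have -> : D n `^ (b - 1) = D n `^ (g + b) * D n `^ (- g - 1).
  by rewrite -powRDp//; congr (_ `^ _); ring.
rewrite 2!mulrA ler_wpM2r ?powR_ge0//.
apply: le_trans (ler_wpM2l (sqr_ge0 delta) h).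
have oo0 : 0 <= omega0 * omega ^+ n.
  by rewrite mulr_ge0 ?exprn_ge0 ?(ltW O0) ?(ltW om0).
rewrite powRM ?invr_ge0// oo_powR etaE deltaE.
have HM' : 2 `^ (g + b + 1) * g / b <= omega `^ ((g + b) * (n%:R - nopt)).
  apply: (le_trans HM); rewrite -powR_mulrn ?powR_ge0// -powRrM.
  apply: ler_powR; first exact: ltW.
  by rewrite ler_wpM2l ?addr_ge0 ?(ltW g_gt0) ?(ltW b_gt0)//; lra.
have gb0 : 0 <= g + b by rewrite addr_ge0 ?(ltW g_gt0) ?(ltW b_gt0).
have -> : 2^-1 `^ (g + b) = (2 `^ (g + b))^-1 :> R.
  by rewrite -(powR_inv1 (a := 2))// -powRrM mulN1r powRN.
have p2 : 0 < 2 `^ (g + b) :> R by rewrite powR_gt0.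
have C0 : 0 <= U * b * omega0 `^ g * (2 `^ (g + b))^-1 * omega `^ (g * nopt).
  by rewrite !mulr_ge0 ?invr_ge0 ?powR_ge0 ?(ltW U_gt0) ?(ltW b_gt0).
have := ler_wpM2l C0 HM'.
set X := omega `^ ((g + b) * n%:R).
have -> : omega `^ ((g + b) * (n%:R - nopt)) =
    X / (omega `^ (g * nopt) * omega `^ (b * nopt)).
  by rewrite /X -powRDp// -powRN -powRDp//; congr (_ `^ _); ring.
rewrite (powRDp (g + b) 1)// powRr1// (mulNr b) !powRN (powRDp g b O0).
have : 0 < omega0 `^ g by rewrite powR_gt0.
have : 0 < omega0 `^ b by rewrite powR_gt0.
have : 0 < omega `^ (g * nopt) by rewrite powR_gt0.
have : 0 < omega `^ (b * nopt) by rewrite powR_gt0.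
move: p2; set a1 := 2 `^ _; set a2 := omega `^ (b * nopt).
set a3 := omega `^ _; set a4 := omega0 `^ b; set a5 := omega0 `^ g.
move=> a10 a20 a30 a40 a50 H.
have -> : 2 * (U * g * a5 * a3) = U * b * a5 * a1^-1 * a3 * (a1 * 2 * g / b).
  by field; rewrite !gt_eqF.
apply: (le_trans H); rewrite le_eqVlt; apply/orP; left; apply/eqP.
by field; rewrite !gt_eqF.
Qed.

End scales.

(** * Integrals of finite sums, tails and geometric series *)

Section integral_bounds.
Context {R : realType} {d : measure_display} {T : measurableType d}.
Import HBNNSimple.
Variable P : probability T R.

(* f is not assumed measurable: the error at the stopping index is only
   compared with measurable functions. *)
Lemma le_integral_off_null (f g : T -> \bar R) (N0 : set T) :
  measurable N0 -> P N0 = 0%E -> (forall w, 0 <= f w)%E -> (forall w, 0 <= g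
    w)%E ->
  measurable_fun setT g -> (forall w, ~ N0 w -> f w <= g w)%E ->
  (\int[P]_w f w <= \int[P]_w g w)%E.
Proof.
move=> mN PN f0 g0 mg fg; rewrite ge0_integralTE//.
apply: ge_ereal_sup => _ [h hf <-]; rewrite -integralT_nnsfun.
apply: ae_ge0_le_integral => //.
- by move=> w _; rewrite lee_fin.
- exact/measurable_EFinP.
- exists N0; split => // w /= hw; apply: contrapT => Nw; apply: hw => _.
  exact: le_trans (hf w) (fg w Nw).
Qed.

Lemma integral_fsum_le (f : nat -> T -> R) (v : nat -> R) (m n : nat) :
  (forall j, measurable_fun setT (f j)) -> (forall j w, 0 <= f j w) ->
  (forall j, (m <= j < n)%N -> \int[P]_w (f j w)%:E <= (v j)%:E)%E ->
  (\int[P]_w (\sum_(m <= j < n) f j w)%:E <= (\sum_(m <= j < n) v j)%:E)%E.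
Proof.
move=> mf f0 fv.
under eq_integral do rewrite -sumEFin.
rewrite ge0_integral_sum//; last 2 first.
- by move=> j; exact/measurable_EFinP.
- by move=> j w _; rewrite lee_fin.
by rewrite -sumEFin big_nat [leRHS]big_nat; apply: lee_sum.
Qed.

Lemma integral_fsum_ge (f : nat -> T -> R) (v : nat -> R) (m n : nat) :
  (forall j, measurable_fun setT (f j)) -> (forall j w, 0 <= f j w) ->
  (forall j, (v j)%:E <= \int[P]_w (f j w)%:E)%E ->
  ((\sum_(m <= j < n) v j)%:E <= \int[P]_w (\sum_(m <= j < n) f j w)%:E)%E.
Proof.
move=> mf f0 fv.
under eq_integral do rewrite -sumEFin.
rewrite ge0_integral_sum//; last 2 first.
- by move=> j; exact/measurable_EFinP.
- by move=> j w _; rewrite lee_fin.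
by rewrite -sumEFin; apply: lee_sum.
Qed.

Lemma measurable_series_from (f : nat -> T -> R) (n : nat) :
  (forall j, measurable_fun setT (f j)) -> (forall j w, 0 <= f j w) ->
  measurable_fun setT (fun w => \sum_(n <= j <oo) (f j w)%:E)%E.
Proof.
move=> mf f0.
rewrite (_ : (fun w => _) =
    (fun w => \sum_(0 <= j <oo | j \in xpredT) (f (j + n)%N w)%:E)%E); last first.
  apply/funext => w; rewrite -nneseries_addn; last by move=> j; rewrite lee_fin.
  exact: eq_eseriesl.
apply: ge0_emeasurable_sum => [j w _ _|j _]; first by rewrite lee_fin.
exact/measurable_EFinP.
Qed.

Lemma integral_series_from (f : nat -> T -> R) (n : nat) :
  (forall j, measurable_fun setT (f j)) -> (forall j w, 0 <= f j w) ->
  (\int[P]_w (\sum_(n <= j <oo) (f j w)%:E) =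
   \sum_(n <= j <oo) \int[P]_w (f j w)%:E)%E.
Proof.
move=> mf f0.
rewrite -[RHS]nneseries_addn; last first.
  by move=> j; apply: integral_ge0 => w _; rewrite lee_fin.
rewrite -integral_nneseries//; last 2 first.
- by move=> j; exact/measurable_EFinP.
- by move=> j w _; rewrite lee_fin.
apply: eq_integral => w _; rewrite -nneseries_addn// => j.
by rewrite lee_fin.
Qed.

Lemma integral_tail_le (f : nat -> T -> R) (kappa g : R) (n : nat) :
  (forall j, measurable_fun setT (f j)) -> (forall j w, 0 <= f j w) ->
  0 <= kappa -> 0 < g -> (0 < n)%N ->
  (forall j, (n <= j)%N ->
    \int[P]_w (f j w)%:E <= (kappa * j.+1%:R `^ (- g - 1))%:E)%E ->
  (\int[P]_w (\sum_(n <= j <oo) (f j w)%:E) <= (kappa * (n%:R `^ (- g) /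
    g))%:E)%E.
Proof.
move=> mf f0 k0 g0 n0 fk; rewrite integral_series_from//.
apply: (@le_trans _ _ (\sum_(n <= j <oo) (kappa%:E * (j.+1%:R `^ (- g -
  1))%:E))%E).
  rewrite -[leRHS]nneseries_addn; last first.
    by move=> j; rewrite mule_ge0 ?lee_fin ?powR_ge0.
  rewrite -[leLHS]nneseries_addn; last first.
    by move=> j; apply: integral_ge0 => w _; rewrite lee_fin.
  apply: lee_nneseries => j; first by move=> _ _; apply: integral_ge0 => w _;
    rewrite lee_fin.
  by move=> _; rewrite -EFinM; apply: fk; rewrite leq_addl.
rewrite nneseriesZl; last by move=> j _; rewrite lee_fin powR_ge0.
by rewrite EFinM lee_wpmul2l ?lee_fin//; exact: nneseries_powR_le.
Qed.

Lemma integral_tail_ge (f : nat -> T -> R) (kappa g : R) (n : nat) :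
  (forall j, measurable_fun setT (f j)) -> (forall j w, 0 <= f j w) ->
  0 <= kappa -> 0 < g -> (0 < n)%N ->
  (forall j, (kappa * j.+1%:R `^ (- g - 1))%:E <= \int[P]_w (f j w)%:E)%E ->
  ((kappa * (2 `^ (- g - 1) * n%:R `^ (- g)))%:E <=
   \int[P]_w (\sum_(n <= j <oo) (f j w)%:E))%E.
Proof.
move=> mf f0 k0 g0 n0 fk; rewrite integral_series_from//.
apply: (@le_trans _ _ (\sum_(n <= j <oo) (kappa%:E * (j.+1%:R `^ (- g -
  1))%:E))%E).
  rewrite nneseriesZl; last by move=> j _; rewrite lee_fin powR_ge0.
  by rewrite EFinM lee_wpmul2l ?lee_fin//; exact: nneseries_powR_ge.
apply: lee_nneseries => j; first by move=> _ _;
  rewrite mule_ge0 ?lee_fin ?powR_ge0.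
by move=> _; rewrite -EFinM; exact: fk.
Qed.

Lemma sum_geometric_le (x : R) (m n : nat) : 0 <= x -> x < 1 ->
  \sum_(m <= i < n) x ^+ i <= (1 - x)^-1.
Proof.
move=> x0 x1; have x10 : 0 < 1 - x by rewrite subr_gt0.
have full : \sum_(0 <= i < n) x ^+ i <= (1 - x)^-1.
  have -> : \sum_(0 <= i < n) x ^+ i = (1 - x ^+ n) / (1 - x).
    apply: (mulIf (lt0r_neq0 x10)); rewrite divfK ?lt0r_neq0//.
    elim: n => [|n ih]; first by rewrite big_geq// mul0r expr0 subrr.
    by rewrite big_nat_recr//= mulrDl ih exprS; ring.
  by rewrite ler_piMl ?invr_ge0 ?(ltW x10)// gerBl exprn_ge0.
apply: le_trans full; have [nm|mn] := leqP n m.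
  by rewrite big_geq// sumr_ge0// => i _; exact: exprn_ge0.
rewrite [leRHS](big_cat_nat _ (n := m)) ?(ltnW mn)//= lerDr.
by apply: sumr_ge0 => i _; exact: exprn_ge0.
Qed.

Lemma integral_geometric_le (f : nat -> T -> R) (kappa x : R) (n : nat) :
  (forall j, measurable_fun setT (f j)) -> (forall j w, 0 <= f j w) ->
  0 <= kappa -> 0 <= x -> x < 1 ->
  (forall j, (n <= j)%N -> \int[P]_w (f j w)%:E <= (kappa * x ^+ j)%:E)%E ->
  (\int[P]_w (\sum_(n <= j <oo) (f j w)%:E) <= (kappa / (1 - x))%:E)%E.
Proof.
move=> mf f0 k0 x0 x1 fk; rewrite integral_series_from//.
apply: lime_le.
  by apply: is_cvg_nneseries => j _ _; apply: integral_ge0 => w _;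
    rewrite lee_fin.
near=> m.
apply: (@le_trans _ _ (\sum_(n <= j < m) (kappa * x ^+ j)%:E)%E).
  by rewrite big_nat [leRHS]big_nat; apply: lee_sum => j /andP[nj _]; exact: fk.
by rewrite sumEFin lee_fin -mulr_sumr ler_wpM2l// sum_geometric_le.
Unshelve. all: by end_near. Qed.

End integral_bounds.

(** One term of the exponential series, exp y >= y^k / k! with an integer k >= p, at y = a om^i;
    hence K = k! / a^k. *)
Lemma exp_tail_geometric (R : realType) (om a p : R) : 1 < om -> 0 < a -> 0 <=
  p ->
  exists2 K, 0 <= K & forall i, expR (- (a * om ^+ i)) <= K * om `^ (- p * i%:R).
Proof.
move=> om1 a0 p0; have om0 : 0 < om by lra.
set n := Num.bound p; have pn : p <= n.+1%:R.
  rewrite -natr1 (le_trans (ler_norm _))// ler_wpDr//.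
  by rewrite ltW// /n; have := archi_boundP p0; rewrite ger0_norm.
have f0 : 0 < (n.+1)`!%:R :> R by rewrite ltr0n fact_gt0.
exists ((n.+1)`!%:R / a ^+ n.+1); first by rewrite divr_ge0 ?exprn_ge0 ?ltW.
move=> i; have y0 : 0 < a * om ^+ i by rewrite mulr_gt0// exprn_gt0.
have h : (a * om ^+ i) ^+ n.+1 / (n.+1)`!%:R <= expR (a * om ^+ i).
  by have := expR_ge1Dxn n (ltW y0); lra.
rewrite expRN.
apply: (@le_trans _ _ ((a * om ^+ i) ^+ n.+1 / (n.+1)`!%:R)^-1).
  by rewrite lef_pV2 ?posrE ?expR_gt0// divr_gt0// exprn_gt0.
rewrite invf_div exprMn invfM mulrA ler_wpM2l ?divr_ge0 ?exprn_ge0 ?(ltW a0)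
  ?(ltW f0)//.
rewrite -exprM -(powR_mulrn _ (ltW om0)) -powRN; apply: ler_powR;
  first exact: ltW.
by rewrite natrM mulNr lerN2 mulrC ler_wpM2l.
Qed.

(** * The error at a data-driven stopping index *)

Section stopped_error.
Context {R : realType} {d : measure_display} {T : measurableType d}.
Variable P : probability T R.
Variables (V : nat + nat -> T -> R) (s c : nat + nat -> R).
Hypothesis s_gt0 : forall i, 0 < s i.
Hypothesis c_gt0 : forall i, 0 < c i.
Hypothesis lawV : forall i, normal_law P (V i) 0 (s i).
Hypothesis indV : mutually_independent P V.
Variables (eta delta g beta omega0 omega tau U nopt : R).
Hypotheses (eta_gt0 : 0 < eta) (delta_gt0 : 0 < delta) (g_gt0 : 0 < g)
  (beta_ge0 : 0 <= beta) (U_gt0 : 0 < U) (nopt_ge0 : 0 <= nopt).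
Hypotheses (omega0_gt1 : 1 < omega0) (omega_gt1 : 1 < omega)
  (omega0_large : 2 <= omega0 * (omega - 1)).
Hypothesis varX : forall j,
  (c (inl j) * s (inl j)) ^+ 2 = eta ^+ 2 * j.+1%:R `^ (- g - 1).
Hypothesis varZ : forall j,
  (c (inr j) * s (inr j)) ^+ 2 = delta ^+ 2 * j.+1%:R `^ beta.
Local Notation b := (beta + 1).
Hypothesis etaE : eta ^+ 2 = U * g * omega0 `^ g * omega `^ (g * nopt).
Hypothesis deltaE : delta ^+ 2 = U * b * omega0 `^ (- b) * omega `^ (- b * nopt).

Local Notation D := (tdim omega0 omega).
Local Notation QX := (fun j w => (c (inl j) * V (inl j) w) ^+ 2).
Local Notation QZ := (fun j w => (c (inr j) * V (inr j) w) ^+ 2).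

Let mQX j : measurable_fun setT (QX j). Proof. exact: (measurable_sq c lawV). Qed.
Let mQZ j : measurable_fun setT (QZ j). Proof. exact: (measurable_sq c lawV). Qed.
Let b_gt0 : 0 < b. Proof. by rewrite ltr_wpDl. Qed.
Let om0 : 0 < omega. Proof. exact: lt_trans omega_gt1. Qed.
Let D0 n : (0 < D n)%N. Proof. exact: tdim_gt0. Qed.

Definition noise_err n w := \sum_(0 <= j < D n) QZ j w.
Definition bias_err n w := (\sum_(D n <= j <oo) (QX j w)%:E)%E.
Let noise_var n := delta ^+ 2 * \sum_(j < D n) j.+1%:R `^ beta.

Let noise_var_le n : noise_var n <= b * U * omega `^ (b * (n%:R - nopt)).
Proof.
apply: le_trans (variance_scale_le omega0_gt1 omega_gt1 b_gt0 deltaE n).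
by rewrite ler_wpM2l ?sqr_ge0//; exact: sum_powR_le.
Qed.

Let noise_var_ge0 n : 0 <= noise_var n.
Proof. by rewrite mulr_ge0 ?sqr_ge0// sumr_ge0// => j _; exact: powR_ge0. Qed.

Let noise_varE n : noise_var n = \sum_(0 <= j < D n) delta ^+ 2 * j.+1%:R `^ beta.
Proof. by rewrite /noise_var mulr_sumr big_mkord. Qed.

Let noise_var_mono n m : (n <= m)%N -> noise_var n <= noise_var m.
Proof.
move=> nm; rewrite !noise_varE [leRHS](big_cat_nat _ (n := D n))//=.
  by rewrite lerDl; apply: sumr_ge0 => j _; rewrite mulr_ge0 ?sqr_ge0 ?powR_ge0.
exact: tdim_le.
Qed.

Let noise_err_le n m w : (n <= m)%N -> noise_err n w <= noise_err m w.
Proof.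
move=> nm; rewrite /noise_err [leRHS](big_cat_nat _ (n := D n))//=.
  by rewrite lerDl; apply: sumr_ge0 => j _; exact: sqr_ge0.
exact: tdim_le.
Qed.

Let noise_err_ge0 n w : 0 <= noise_err n w.
Proof. by apply: sumr_ge0 => j _; exact: sqr_ge0. Qed.

Let measurable_noise_err n : measurable_fun setT (noise_err n).
Proof. by apply: measurable_sum => j; exact: mQZ. Qed.

Let bias_err_ge0 n w : (0 <= bias_err n w)%E.
Proof. by apply: nneseries_ge0 => j _ _; rewrite lee_fin sqr_ge0. Qed.

Let measurable_bias_err n : measurable_fun setT (bias_err n).
Proof.
by apply: measurable_series_from => [j|j w]; [exact: mQX|exact: sqr_ge0].
Qed.

Let bias_err_split n m w : (n <= m)%N ->
  bias_err n w = ((\sum_(D n <= j < D m) QX j w)%:E + bias_err m w)%E.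
Proof.
move=> nm; rewrite /bias_err (@nneseries_split _ _ _ (D m - D n)); last first.
  by move=> j _; rewrite lee_fin sqr_ge0.
by rewrite subnKC ?sumEFin//; exact: tdim_le.
Qed.

Let bias_err_le n m w : (n <= m)%N -> (bias_err m w <= bias_err n w)%E.
Proof.
move=> nm; rewrite (bias_err_split w nm) leeDr// lee_fin.
by apply: sumr_ge0 => j _; exact: sqr_ge0.
Qed.

Lemma mean_noise_err_le n : (\int[P]_w (noise_err n w)%:E <= (6 * noise_var
  n)%:E)%E.
Proof.
rewrite noise_varE mulr_sumr; apply: integral_fsum_le => //.
- by move=> j w; exact: sqr_ge0.
- by move=> j _; rewrite -varZ; exact: (sq_moment_le s_gt0 c_gt0 lawV).
Qed.

Lemma mean_noise_err_ge n : ((noise_var n / 2)%:E <= \int[P]_w (noise_err n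
  w)%:E)%E.
Proof.
rewrite noise_varE mulr_suml; apply: integral_fsum_ge => //.
- by move=> j w; exact: sqr_ge0.
- by move=> j; rewrite -varZ; exact: (sq_moment_ge s_gt0 c_gt0 lawV).
Qed.

(** Up to n_opt the bias alone is of order [U], beyond it the noise alone: on its own side each
    power of [omega] is at least 1. *)
Lemma mean_error_ge n :
  ((Num.min (2 `^ (- g - 1) * g) (4 `^ (- b) * b) / 2 * U)%:E <=
   \int[P]_w ((noise_err n w)%:E + bias_err n w))%E.
Proof.
rewrite ge0_integralD//; last 2 first.
- by move=> w _; rewrite lee_fin noise_err_ge0.
- by apply/measurable_EFinP; exact: measurable_noise_err.
have U2 : 0 <= U / 2 by rewrite divr_ge0// ltW.
have [nn|nn] := leP n%:R nopt.
  rewrite -[leLHS]add0e leeD//.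
    by apply: integral_ge0 => w _; rewrite lee_fin noise_err_ge0.
  have k0 : 0 <= eta ^+ 2 / 2 by rewrite divr_ge0// sqr_ge0.
  apply: le_trans (integral_tail_ge mQX _ k0 g_gt0 (D0 n) _); last 2 first.
  - by move=> j w; exact: sqr_ge0.
  - move=> j; apply: le_trans (sq_moment_ge s_gt0 c_gt0 lawV (inl j)).
    by rewrite varX lee_fin; lra.
  have := bias_scale_ge omega0_gt1 omega_gt1 g_gt0 etaE n => h.
  have h1 : 1 <= omega `^ (- g * (n%:R - nopt)).
    rewrite -[leLHS](powRr0 omega); apply: ler_powR; first exact: ltW.
    by rewrite mulNr -mulrN opprB mulr_ge0 ?subr_ge0// ltW.
  have h2 : 0 <= 2 `^ (- g - 1) * g * U.
    by rewrite !mulr_ge0 ?powR_ge0// ltW.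
  have := ler_wpM2l h2 h1 => h3.
  have h4 : Num.min (2 `^ (- g - 1) * g) (4 `^ (- b) * b) <= 2 `^ (- g - 1) * g.
    by rewrite ge_min lexx.
  have := ler_wpM2r U2 h4; rewrite lee_fin; lra.
rewrite -[leLHS]adde0 leeD//; last by apply: integral_ge0.
apply: le_trans (mean_noise_err_ge n).
have h : 4 `^ (- b) * b * U * omega `^ (b * (n%:R - nopt)) <= noise_var n.
  apply: le_trans (variance_scale_ge omega0_gt1 omega_gt1 b_gt0 deltaE n) _.
  by rewrite ler_wpM2l ?sqr_ge0//; exact: sum_powR_ge.
have h1 : 1 <= omega `^ (b * (n%:R - nopt)).
  rewrite -[leLHS](powRr0 omega); apply: ler_powR; first exact: ltW.
  by rewrite mulr_ge0 ?subr_ge0// ltW.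
have h2 : 0 <= 4 `^ (- b) * b * U.
  by rewrite !mulr_ge0 ?powR_ge0// ltW.
have := ler_wpM2l h2 h1 => h3.
have h4 : Num.min (2 `^ (- g - 1) * g) (4 `^ (- b) * b) <= 4 `^ (- b) * b.
  by rewrite ge_min lexx orbT.
have := ler_wpM2r U2 h4; rewrite lee_fin; lra.
Qed.

(* r n is the squared noise level; F n and E n are the events that the
   balancing functional at n is small, resp. large. *)
Variables (r : nat -> R) (F E : nat -> set T).
Hypothesis r_ge : forall n, noise_var n <= 2 * r n.
Hypothesis r_le : forall n, r n <= 6 * noise_var n.
Hypothesis mF : forall n, measurable (F n).
Hypothesis mE : forall n, measurable (E n).
Hypothesis FX : forall n w, F n w -> \sum_(D n <= j < D n.+1) QX j w <=
  32 * tau ^+ 2 * r n.+1 + 2 * \sum_(D n <= j < D n.+1) QZ j w.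
Hypothesis EX : forall n w, E n w -> 8 * r n.+1 <=
  \sum_(D n <= j < D n.+1) QX j w + \sum_(D n <= j < D n.+1) QZ j w.

Let r_ge0 n : 0 <= r n.
Proof. by have := noise_var_ge0 n; have := r_ge n; lra. Qed.

Variables (M : nat) (K : R).
Hypothesis HM : 2 `^ (g + b + 1) * g / b <= (omega `^ (g + b)) ^+ M.
Hypothesis K_ge0 : 0 <= K.
Hypothesis HK : forall i,
  expR (- ((8 * 2 `^ b)^-1 * omega ^+ i)) <= K * omega `^ (- (b + 1) * i%:R).
(** [m0] is n_opt rounded up, and [L] a level from which the bound on large blocks applies. *)
Variable m0 : nat.
Hypotheses (nopt_m0 : nopt <= m0%:R) (m0_nopt : m0%:R < nopt + 1).
Local Notation L := (m0 + M)%N.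
(** In the rate b + 1, the part b offsets the growth of the noise variance and the 1 leaves a
    summable omega^(-i). *)
Let q i := K * omega `^ (- (b + 1) * i%:R).

Let q_ge0 i : 0 <= q i. Proof. by rewrite mulr_ge0// powR_ge0. Qed.

Let q_leS i : q i.+1 <= q i.
Proof.
rewrite ler_wpM2l// ler_powR ?(ltW omega_gt1)//.
by rewrite !mulNr lerN2 ler_wpM2l ?ler_nat// addr_ge0// ltW.
Qed.

Let large_block i : (L <= i)%N -> (P (E i) <= (q i)%:E)%E /\
  forall k, ~~ (D i <= k < D i.+1)%N -> (\int[P]_w (QZ k w * \1_(E i) w)%:E <=
    (q i * (6 * (delta ^+ 2 * k.+1%:R `^ beta)))%:E)%E.
Proof.
move=> Li.
have Di : (D i < D i.+1)%N.
  by rewrite (leq_trans _ (tdim_block_ge2 omega0_gt1 omega_gt1 omega0_large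
    i))// addn2.
have cond := bias_le_variance omega0_gt1 omega_gt1 g_gt0 b_gt0 U_gt0 etaE
  deltaE HM.
have {}cond : 2 * (eta ^+ 2 * (D i)%:R `^ (- g - 1)) <= delta ^+ 2 * (D i)%:R
  `^ beta.
  have := cond i; rewrite addrK; apply.
  by rewrite (le_trans (lerD nopt_m0 (lexx _)))// -natrD ler_nat.
have [PE intE] := large_block_bound s_gt0 c_gt0 lawV indV delta_gt0 g_gt0
  beta_ge0 varX varZ (D0 i) Di cond (r_ge i.+1) (mE i) (@EX i).
(* The 8 in [HK] is the 4 of the block bound times the 2 lost in D (i+1) >= omega^i / 2. *)
have qle : expR (- ((D i.+1)%:R / (4 * 2 `^ b))) <= q i.
  apply: le_trans (HK i); rewrite ler_expR lerN2.
  have p2 : 0 < 2 `^ b :> R by rewrite powR_gt0.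
  have -> : (8 * 2 `^ b)^-1 * omega ^+ i = omega ^+ i / 2 / (4 * 2 `^ b).
    by field; rewrite gt_eqF.
  rewrite ler_pM2r ?invr_gt0 ?mulr_gt0// ler_pdivrMr// mulrC.
  apply: le_trans (le_tdim2 omega0_gt1 omega_gt1 i.+1).
  rewrite exprS mulrA ler_peMl ?exprn_ge0 ?(ltW om0)//.
  rewrite -[leLHS]mulr1; apply: ler_pM => //; exact: ltW.
split; first by rewrite (le_trans PE)// lee_fin.
move=> k kD; apply: (le_trans (intE k kD)).
by rewrite lee_fin ler_wpM2r// mulr_ge0// mulr_ge0 ?sqr_ge0 ?powR_ge0.
Qed.

(** The intersection lies in every [E i], and their probabilities tend to 0. It is the exceptional
    set outside which some level passes the test. *)
Lemma null_bigcap_large : P (\bigcap_i E i) = 0%E.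
Proof.
have mN : measurable (\bigcap_i E i) by exact: bigcapT_measurable.
have PN : (P (\bigcap_i E i) \is a fin_num)%E by exact: fin_num_measure.
have PNq i : (L <= i)%N -> fine (P (\bigcap_i E i)) <= K * (omega ^+ i)^-1.
  move=> Li; rewrite -lee_fin fineK//.
  apply: (@le_trans _ _ (P (E i))).
    by apply: le_measure; rewrite ?inE//; exact: bigcap_inf.
  have [PE _] := large_block Li; apply: (le_trans PE).
  rewrite lee_fin ler_wpM2l// -powR_mulrn ?(ltW om0)// -powRN.
  apply: ler_powR; first exact: ltW.
  by rewrite mulNr lerN2 ler_peMl// lerDr ltW.
have p0 : 0 <= fine (P (\bigcap_i E i)) by exact: fine_ge0.
apply/eqP; rewrite -(fineK PN) eqe eq_le p0 andbT leNgt; apply/negP => p1.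
have [n Kn] := bernoulli_archi ((K + 1) / fine (P (\bigcap_i E i))) omega_gt1.
have := PNq (n + L)%N (leq_addl _ _).
have omn : 0 < omega ^+ (n + L) by rewrite exprn_gt0.
rewrite ler_pdivlMr// => H.
have : omega ^+ n <= omega ^+ (n + L).
  by rewrite ler_weXn2l ?(ltW omega_gt1)// leq_addr.
move: Kn; rewrite ler_pdivrMr// => Kn h.
have := ler_wpM2l p0 h; lra.
Qed.

(** The bias left after a stop at [i], without the block that controls [F i]. *)
Let bias_after i w : \bar R :=
  (\sum_(D i.+1 <= j <oo) (QX j w * \1_(F i) w)%:E)%E.

(** Serves for a stop at i + 2, where both [E i] and [E i.+1] hold: each part of the noise is paired
    with the event whose block does not contain it. *)
Let noise_after i w :=
  \sum_(0 <= j < D i.+1) QZ j w * \1_(E i.+1) w +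
  \sum_(D i.+1 <= j < D i.+2) QZ j w * \1_(E i) w.

Let mQX1 i j : measurable_fun setT (fun w => QX j w * \1_(F i) w).
Proof. by apply: measurable_funM => //; exact: measurable_indic. Qed.

Let mQZ1 i j : measurable_fun setT (fun w => QZ j w * \1_(E i) w).
Proof. by apply: measurable_funM => //; exact: measurable_indic. Qed.

Let QX1_ge0 i j w : 0 <= QX j w * \1_(F i) w.
Proof. by rewrite mulr_ge0// sqr_ge0. Qed.

Let QZ1_ge0 i j w : 0 <= QZ j w * \1_(E i) w.
Proof. by rewrite mulr_ge0// sqr_ge0. Qed.

Let measurable_noise_after i : measurable_fun setT (noise_after i).
Proof.
by apply: measurable_funD; apply: measurable_sum => j.
Qed.

Let noise_after_ge0 i w : 0 <= noise_after i w.
Proof. by rewrite addr_ge0// sumr_ge0. Qed.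

Let x := omega `^ (- b).

(** Summing [small_block_bound] over the tail cancels eta, and the powers of D (i+1) combine into
    the scale of the noise variance at level i + 1. *)
Let mean_bias_after i :
  (\int[P]_w bias_after i w <=
   (6 * (4 * expR (24 * tau ^+ 2 * (2 * omega / (omega - 1)))) ^+ 2 / g *
     (b * U * omega `^ (b * (i.+1%:R - nopt))))%:E)%E.
Proof.
set A := (4 * _) ^+ 2.
have A0 : 0 <= A by exact: sqr_ge0.
have gi : 0 <= g^-1 by rewrite invr_ge0 ltW.
have D1 : 0 < (D i.+1)%:R :> R by rewrite ltr0n.
apply: (@le_trans _ _ (((A * (delta ^+ 2 / eta ^+ 2) *
    (D i.+1)%:R `^ (beta + g + 1) * (6 * eta ^+ 2)) *
    ((D i.+1)%:R `^ (- g) / g))%:E)); last first.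
  rewrite lee_fin.
  have -> : A * (delta ^+ 2 / eta ^+ 2) * (D i.+1)%:R `^ (beta + g + 1) *
      (6 * eta ^+ 2) * ((D i.+1)%:R `^ (- g) / g) =
      6 * A / g * (delta ^+ 2 * (D i.+1)%:R `^ b).
    have -> : (D i.+1)%:R `^ b = (D i.+1)%:R `^ (beta + g + 1) * (D i.+1)%:R
      `^ (- g) :> R.
      by rewrite -powRDp//; congr (_ `^ _); ring.
    by field; rewrite !gt_eqF.
  rewrite ler_wpM2l ?mulr_ge0//.
  exact: variance_scale_le.
apply: integral_tail_le => //.
- have e0 : 0 <= eta ^+ 2 by exact: sqr_ge0.
  have d0 : 0 <= delta ^+ 2 / eta ^+ 2 by rewrite divr_ge0// sqr_ge0.
  by do !apply: mulr_ge0 => //; exact: powR_ge0.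
- move=> j Dj; have Dle := tdim_le_block omega0_gt1 omega_gt1 omega0_large i.
  have rle : r i.+1 <= 6 * (delta ^+ 2 * (D i.+1)%:R `^ b).
    rewrite (le_trans (r_le i.+1))// ler_wpM2l// ler_wpM2l ?sqr_ge0//.
    exact: sum_powR_le.
  have := small_block_bound s_gt0 c_gt0 lawV indV eta_gt0 delta_gt0 g_gt0
    beta_ge0 varX varZ (D0 i)
    (tdim_block_ge2 omega0_gt1 omega_gt1 omega0_large i) Dle (r_ge0 i.+1) rle
    (mF i) (@FX i) Dj.
  by move/le_trans; apply; rewrite -/A lee_fin le_eqVlt; apply/orP; left;
    apply/eqP; ring.
Qed.

(** As m0 < nopt + 1, the term at [i] is at most b U omega^b x^(m0 - i - 1): a geometric sum read
    backwards from [m0]. *)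
Let sum_mean_bias_after :
  \sum_(0 <= i < m0) b * U * omega `^ (b * (i.+1%:R - nopt)) <=
  b * U * omega `^ b / (1 - x).
Proof.
have bU : 0 <= b * U by rewrite mulr_ge0// ltW.
have x0 : 0 <= x by exact: powR_ge0.
have x1 : x < 1.
  rewrite /x powRN invf_lt1 ?powR_gt0//.
  rewrite -[ltLHS](_ : 1 `^ b = 1); last by rewrite powR1.
  by apply: gt0_ltr_powR; rewrite ?nnegrE// ltW.
apply: (@le_trans _ _ (b * U * omega `^ b * \sum_(0 <= i < m0) x ^+ (m0 - i.+1))).
  rewrite mulr_sumr; apply: ler_sum_nat => i /andP[_ im].
  rewrite -[leRHS]mulrA ler_wpM2l//.
  rewrite -powR_mulrn// /x -powRrM -powRDp//; apply: ler_powR; first exact: ltW.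
  rewrite natrB//.
  apply: (@le_trans _ _ (b * (1 - (m0%:R - i.+1%:R)))); last by lra.
  by rewrite ler_wpM2l ?(ltW b_gt0)//; move: m0_nopt; lra.
rewrite ler_wpM2l ?mulr_ge0 ?powR_ge0 ?(ltW b_gt0) ?(ltW U_gt0)//.
rewrite big_mkord (reindex_inj rev_ord_inj)/=.
rewrite (eq_bigr (fun i : 'I_m0 => x ^+ i)); last first.
  by move=> i _; congr (_ ^+ _); rewrite /= subnSK// subKn// ltnW.
by rewrite -(big_mkord xpredT (fun i => x ^+ i)) sum_geometric_le.
Qed.

(** Each of the two pairings costs 6 q_i times the noise variance at level i + 2. The exponents add
    up to 2 b - i - b nopt, and nopt >= 0 removes the last term. *)
Let mean_noise_after i : (L <= i)%N ->
  (\int[P]_w (noise_after i w)%:E <=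
   (12 * K * (b * U * omega `^ (2 * b)) * omega^-1 ^+ i)%:E)%E.
Proof.
move=> Li.
have bU : 0 <= b * U by rewrite mulr_ge0// ltW.
apply: (@le_trans _ _ (12 * q i * noise_var i.+2)%:E); last first.
  rewrite lee_fin.
  apply: (@le_trans _ _ (12 * q i * (b * U * omega `^ (b * (i.+2%:R - nopt))))).
    by rewrite ler_wpM2l ?noise_var_le// mulr_ge0// q_ge0.
  have -> : 12 * q i * (b * U * omega `^ (b * (i.+2%:R - nopt))) =
      12 * K * (b * U) * (omega `^ (- (b + 1) * i%:R) * omega `^ (b * (i.+2%:R
        - nopt))).
    by rewrite /q; ring.
  have -> : 12 * K * (b * U * omega `^ (2 * b)) * omega^-1 ^+ i =
      12 * K * (b * U) * (omega `^ (2 * b) * omega^-1 ^+ i) by ring.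
  have c0 : 0 <= 12 * K * (b * U) by rewrite mulr_ge0// mulr_ge0.
  apply: (ler_wpM2l c0); rewrite exprVn -powR_mulrn ?(ltW om0)// -powRN
    -!powRDp//.
  apply: ler_powR; first exact: ltW.
  have := mulr_ge0 (ltW b_gt0) nopt_ge0.
  by rewrite -[i.+2]addn2 natrD; lra.
have [_ h1] := large_block (leq_trans Li (leqnSn i)).
have [_ h2] := large_block Li.
have mh (f : T -> R) : measurable_fun setT f -> measurable_fun setT (fun w =>
  (f w)%:E).
  by move=> mf; exact/measurable_EFinP.
under eq_integral do rewrite EFinD.
rewrite ge0_integralD//; first last.
- by apply: mh; apply: measurable_sum => j.
- by move=> w _; rewrite lee_fin sumr_ge0.
- by apply: mh; apply: measurable_sum => j.
- by move=> w _; rewrite lee_fin sumr_ge0.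
have -> : 12 * q i * noise_var i.+2 =
  6 * q i * noise_var i.+2 + 6 * q i * noise_var i.+2 by ring.
rewrite EFinD leeD//.
  apply: (@le_trans _ _ (\sum_(0 <= j < D i.+1)
      q i.+1 * (6 * (delta ^+ 2 * j.+1%:R `^ beta)))%:E).
    apply: integral_fsum_le => // j /andP[_ jD]; apply: h1.
    by rewrite negb_and -ltnNge jD.
  rewrite lee_fin -!mulr_sumr big_mkord.
  apply: (@le_trans _ _ (q i * (6 * noise_var i.+1))).
    by rewrite ler_wpM2r ?q_leS// mulr_ge0// noise_var_ge0.
  have q6 : 0 <= 6 * q i by rewrite mulr_ge0// q_ge0.
  by rewrite mulrA (mulrC (q i)) (ler_wpM2l q6)// noise_var_mono.
apply: (@le_trans _ _ (\sum_(D i.+1 <= j < D i.+2)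
    q i * (6 * (delta ^+ 2 * j.+1%:R `^ beta)))%:E).
  apply: integral_fsum_le => // j /andP[jD _]; apply: h2.
  by rewrite negb_and -leqNgt jD orbT.
have q6 : 0 <= 6 * q i by rewrite mulr_ge0// q_ge0.
rewrite lee_fin -2!mulr_sumr mulrA (mulrC (q i)) (ler_wpM2l q6)//.
rewrite noise_varE [leRHS](big_cat_nat _ (n := D i.+1)) ?tdim_leS//=.
by rewrite lerDr; apply: sumr_ge0 => j _; rewrite mulr_ge0 ?sqr_ge0 ?powR_ge0.
Qed.

(** In units of [U]: the bias at [m0], the block compared with noise, the tails after early stops,
    the noise at [L.+1], and the late stops. *)
Definition stopping_const : R :=
  6 * 2 `^ g + (192 * tau ^+ 2 + 12) * (b * omega `^ b) +
  6 * (4 * expR (24 * tau ^+ 2 * (2 * omega / (omega - 1)))) ^+ 2 / g *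
    (b * omega `^ b / (1 - omega `^ (- b))) +
  6 * (b * omega `^ (b * (M%:R + 2))) +
  12 * K * (b * omega `^ (2 * b)) / (1 - omega^-1).

(** The stopping rule enters only through the two properties that follow. *)
Variable nf : T -> nat.
Hypothesis nf_small : forall w, ~ (\bigcap_i E i) w -> (nf w)%:R < nopt -> F
  (nf w) w.
Hypothesis nf_large : forall w i, (i < nf w)%N -> E i w.

Let bias_after_ge0 i w : (0 <= bias_after i w)%E.
Proof. by apply: nneseries_ge0 => j _ _; rewrite lee_fin. Qed.

Let measurable_bias_after i : measurable_fun setT (bias_after i).
Proof. exact: measurable_series_from. Qed.

Let bias_at_stop w : ~ (\bigcap_i E i) w ->
  (bias_err (nf w) w <= bias_err m0 w +
    ((192 * tau ^+ 2 * noise_var m0 + 2 * noise_err m0 w)%:E +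
     \sum_(0 <= i < m0) bias_after i w))%E.
Proof.
move=> Nw; set n := nf w.
have c0 : 0 <= 192 * tau ^+ 2 * noise_var m0 + 2 * noise_err m0 w.
  have := mulr_ge0 (sqr_ge0 tau) (noise_var_ge0 m0).
  have := noise_err_ge0 m0 w; lra.
have s0 : (0 <= \sum_(0 <= i < m0) bias_after i w)%E by apply: sume_ge0.
have [m0n|nm0] := leqP m0 n.
  by rewrite (le_trans (bias_err_le w m0n))// leeDl// adde_ge0// lee_fin.
(* From n + 1 <= m0 < nopt + 1; thus [F n] holds, which bounds the block by noise up to level [m0],
   and the tail is one term of the sum. *)
have nn : n%:R < nopt.
  rewrite -(ltrD2r 1); apply: le_lt_trans m0_nopt.
  by rewrite natr1 ler_nat.
have Fn := nf_small Nw nn.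
rewrite (bias_err_split w (leqnSn n)) -[leLHS]add0e leeD// leeD//.
- rewrite lee_fin; apply: (le_trans (FX Fn)).
  have h1 : r n.+1 <= 6 * noise_var m0.
    by apply: (le_trans (r_le n.+1)); rewrite ler_wpM2l// noise_var_mono.
  have h2 : \sum_(D n <= j < D n.+1) QZ j w <= noise_err m0 w.
    apply: le_trans (noise_err_le w nm0).
    rewrite /noise_err [leRHS](big_cat_nat _ (n := D n)) ?tdim_leS//=.
    by rewrite lerDr; apply: sumr_ge0 => j _; exact: sqr_ge0.
  by have := ler_wpM2l (sqr_ge0 tau) h1; lra.
- rewrite big_mkord (bigD1 (Ordinal nm0))//= -[leLHS]adde0 leeD//;
  last by apply: sume_ge0.
  rewrite /bias_err /bias_after le_eqVlt; apply/orP; left; apply/eqP.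
  by apply: eq_eseriesr => j _; rewrite indicE mem_set// mulr1.
Qed.

Let noise_at_stop w :
  ((noise_err (nf w) w)%:E <=
   (noise_err L.+1 w)%:E + \sum_(L <= i <oo) (noise_after i w)%:E)%E.
Proof.
have s0 m : (0 <= \sum_(m <= i <oo) (noise_after i w)%:E)%E.
  by apply: nneseries_ge0 => i _ _; rewrite lee_fin.
have [nL|] := leqP (nf w) L.+1.
  by rewrite -[leLHS]adde0 leeD// lee_fin noise_err_le.
(* Beyond [L.+1] the index is n + 2 with n >= L. Both indicators in [noise_after n] equal 1, so this
   single term of the series is the noise error. *)
case En : (nf w) => [//|[//|n]]; rewrite !ltnS => Ln.
rewrite -[leLHS]add0e leeD//; first by rewrite lee_fin noise_err_ge0.
rewrite (@nneseries_split _ _ _ (n - L)); last first.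
  by move=> j _; rewrite lee_fin.
rewrite subnKC// -[leLHS]add0e leeD//.
  by apply: sume_ge0 => j _; rewrite lee_fin.
rewrite (@nneseries_split _ _ _ 1%N); last by move=> j _; rewrite lee_fin.
rewrite addn1 big_nat1 -[leLHS]adde0 leeD// lee_fin /noise_after.
have E1 : E n.+1 w by apply: nf_large; rewrite En.
have E0 : E n w by apply: nf_large; rewrite En ltnS.
rewrite !indicE !mem_set// /noise_err (big_cat_nat _ (n := D n.+1)) ?tdim_leS//=.
by rewrite lerD// le_eqVlt; apply/orP; left; apply/eqP; apply: eq_bigr => j _;
  rewrite mulr1.
Qed.

(** Off the null set, [G1], [G2], [G3] dominate the bias at the stop and [G4], [G5] the noise; each
    has mean at most a multiple of [U]. *)
Lemma stopped_error_le :
  (\int[P]_w ((noise_err (nf w) w)%:E + bias_err (nf w) w) <=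
   (stopping_const * U)%:E)%E.
Proof.
have mN : measurable (\bigcap_i E i) by exact: bigcapT_measurable.
pose G1 w := bias_err m0 w.
pose G2 w := (192 * tau ^+ 2 * noise_var m0 + 2 * noise_err m0 w)%:E.
pose G3 w := (\sum_(0 <= i < m0) bias_after i w)%E.
pose G4 w := (noise_err L.+1 w)%:E.
pose G5 w := (\sum_(L <= i <oo) (noise_after i w)%:E)%E.
have G10 w : (0 <= G1 w)%E by exact: bias_err_ge0.
have c2 : 0 <= 192 * tau ^+ 2 * noise_var m0.
  by have := mulr_ge0 (sqr_ge0 tau) (noise_var_ge0 m0); lra.
have G20 w : (0 <= G2 w)%E by rewrite lee_fin addr_ge0// mulr_ge0// noise_err_ge0.
have G30 w : (0 <= G3 w)%E by apply: sume_ge0.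
have G40 w : (0 <= G4 w)%E by rewrite lee_fin noise_err_ge0.
have G50 w : (0 <= G5 w)%E by apply: nneseries_ge0 => j _ _; rewrite lee_fin.
have mS2 : measurable_fun setT (fun w => 2 * noise_err m0 w).
  by apply: measurable_funM.
have mG1 : measurable_fun setT G1 by exact: measurable_bias_err.
have mG2 : measurable_fun setT G2.
  by apply/measurable_EFinP; apply: measurable_funD.
have mG3 : measurable_fun setT G3 by apply: emeasurable_sum => i;
  exact: measurable_bias_after.
have mG4 : measurable_fun setT G4 by apply/measurable_EFinP.
have mG5 : measurable_fun setT G5 by apply: measurable_series_from.
pose G w := (G1 w + (G2 w + (G3 w + (G4 w + G5 w))))%E.
have mG45 := emeasurable_funD mG4 mG5.
have mG35 := emeasurable_funD mG3 mG45.
have mG25 := emeasurable_funD mG2 mG35.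
have mG15 := emeasurable_funD mG1 mG25.
apply: (@le_trans _ _ (\int[P]_w G w)%E).
  apply: (le_integral_off_null mN null_bigcap_large) => //.
  - by move=> w; rewrite adde_ge0 ?lee_fin ?noise_err_ge0 ?bias_err_ge0.
  - by move=> w; rewrite /G !adde_ge0.
  - move=> w Nw; rewrite /G addrC.
    have := leeD (bias_at_stop Nw) (noise_at_stop w).
    by rewrite -!addeA.
have U0 := ltW U_gt0.
have bU : 0 <= b * U by rewrite mulr_ge0// ltW.
have m0n : m0%:R - nopt <= 1 by move: m0_nopt; lra.
have om1 : 1 <= omega by exact: ltW.
have v0 : noise_var m0 <= b * U * omega `^ b.
  apply: (le_trans (noise_var_le m0)); rewrite ler_wpM2l// ler_powR//.
  by rewrite ler_piMr// ltW.
have I1 : (\int[P]_w G1 w <= (6 * 2 `^ g * U)%:E)%E.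
  apply: (@le_trans _ _ (6 * eta ^+ 2 * ((D m0)%:R `^ (- g) / g))%:E).
    apply: integral_tail_le => //.
    - by move=> j w; exact: sqr_ge0.
    - by rewrite mulr_ge0// sqr_ge0.
    - by move=> j _; rewrite -mulrA -varX; exact: (sq_moment_le s_gt0 c_gt0 lawV).
  rewrite lee_fin -[leLHS]mulrA -[leRHS]mulrA ler_wpM2l//.
  apply: (le_trans (bias_scale_le omega0_gt1 omega_gt1 g_gt0 etaE m0)).
  rewrite ler_piMr ?mulr_ge0 ?powR_ge0// -[leRHS](powRr0 omega) ler_powR//.
  by rewrite mulNr oppr_le0 mulr_ge0 ?subr_ge0// ltW.
have I2 : (\int[P]_w G2 w <= ((192 * tau ^+ 2 + 12) * (b * U * omega `^ b))%:E)%E.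
  under eq_integral do rewrite /G2 EFinD.
  rewrite ge0_integralD//; first last.
  - by apply/measurable_EFinP.
  - by move=> w _; rewrite lee_fin mulr_ge0// noise_err_ge0.
  have Ic k : (\int[P]_w k%:E = k%:E)%E.
    rewrite (@integral_cst _ _ _ P setT)// -[RHS]mule1; congr (_ * _)%E.
    exact: probability_setT.
  rewrite Ic.
  under eq_integral do rewrite EFinM.
  rewrite ge0_integralZl_EFin//; first last.
  - by apply/measurable_EFinP.
  - by move=> w _; rewrite lee_fin noise_err_ge0.
  have h := mean_noise_err_le m0.
  have h2 : (2%:E * \int[P]_w (noise_err m0 w)%:E <= 2%:E * (6 * noise_var
    m0)%:E)%E.
    by rewrite lee_wpmul2l// lee_fin.
  apply: (le_trans (leeD (lexx _) h2)); rewrite -EFinM -EFinD lee_fin.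
  by have := ler_wpM2l (sqr_ge0 tau) v0; lra.
set A := 6 * (4 * expR (24 * tau ^+ 2 * (2 * omega / (omega - 1)))) ^+ 2 / g.
have A0 : 0 <= A by rewrite divr_ge0 ?(ltW g_gt0)// mulr_ge0// sqr_ge0.
have I3 : (\int[P]_w G3 w <= (A * (b * U * omega `^ b / (1 - x)))%:E)%E.
  rewrite ge0_integral_sum//.
  apply: (@le_trans _ _ (\sum_(0 <= i < m0)
      (A * (b * U * omega `^ (b * (i.+1%:R - nopt))))%:E)%E).
    by apply: lee_sum => i _; exact: mean_bias_after.
  by rewrite sumEFin lee_fin -mulr_sumr ler_wpM2l.
have I4 : (\int[P]_w G4 w <= (6 * (b * U * omega `^ (b * (M%:R + 2))))%:E)%E.
  apply: (le_trans (mean_noise_err_le _)); rewrite lee_fin ler_wpM2l//.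
  apply: (le_trans (noise_var_le _)); rewrite ler_wpM2l// ler_powR//.
  rewrite ler_wpM2l ?(ltW b_gt0)// -natr1 natrD; lra.
have I5 : (\int[P]_w G5 w <= (12 * K * (b * U * omega `^ (2 * b)) / (1 -
  omega^-1))%:E)%E.
  apply: integral_geometric_le => //.
  - by rewrite mulr_ge0 ?mulr_ge0 ?powR_ge0 ?(ltW b_gt0).
  - by rewrite invr_ge0 ltW.
  - by rewrite invf_lt1.
rewrite /G ge0_integralD//; last by move=> w _; rewrite !adde_ge0.
rewrite ge0_integralD//; last by move=> w _; rewrite !adde_ge0.
rewrite ge0_integralD//; last by move=> w _; rewrite !adde_ge0.
rewrite ge0_integralD//.
apply: le_trans (leeD I1 (leeD I2 (leeD I3 (leeD I4 I5)))) _.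
rewrite -!EFinD lee_fin le_eqVlt; apply/orP; left; apply/eqP.
by rewrite /stopping_const -/A -/x; ring.
Qed.

End stopped_error.

(** * Truncated singular value decomposition and balancing *)

Section orthonormal_basis.
Context {R : realType} (X : completeNormedModType R).
Variables (ip : {dot X for idfun}) (u : nat -> X).
Hypotheses (hX : norm_from_dot ip) (hu : orthonormal_basis ip u).

Lemma ip_sum_basis (a : nat -> R) (n k : nat) :
  ip (\sum_(j < n) a j *: u j) (u k) = if (k < n)%N then a k else 0.
Proof.
rewrite linear_sumlz.
under eq_bigr => j _ do rewrite linearZl_LR /= hu.1.
case: ifPn => kn.
  rewrite (bigD1 (Ordinal kn))//= eqxx mulr1 big1 ?addr0// => j jk.
  by rewrite (_ : (j == k :> nat) = false) ?mulr0//; apply/eqP => jk';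
    case/eqP: jk; exact: val_inj.
by apply: big1 => j _; rewrite (_ : (j == k :> nat) = false) ?mulr0//;
  apply/eqP => jk; move: kn; rewrite -jk ltn_ord.
Qed.

Lemma norm_sum_basis (a : nat -> R) (m n : nat) :
  `|\sum_(m <= j < n) a j *: u j| ^+ 2 = \sum_(m <= j < n) a j ^+ 2.
Proof.
rewrite hX linear_sumlz; apply: eq_big_nat => j /andP[mj jn].
rewrite linearZl_LR /= linear_sumr.
rewrite (bigD1_seq j) ?mem_index_iota ?mj ?iota_uniq//=.
rewrite linearZr /= hu.1 eqxx mulr1 big1 ?addr0 ?expr2// => i ij.
by rewrite linearZr /= hu.1 eq_sym (negbTE ij) mulr0.
Qed.

(** Partial sums of squares are squared norms of partial expansions, and the norm is continuous. *)
Lemma parseval (y : X) :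
  ((`|y| ^+ 2)%:E = \sum_(0 <= j <oo) ((ip y (u j)) ^+ 2)%:E)%E.
Proof.
apply/esym/cvg_lim => //.
rewrite (_ : (fun n => _) =
    (fun n => (`|series (fun j => ip y (u j) *: u j) n| ^+ 2)%:E)); last first.
  by apply/funext => n; rewrite /series /= norm_sum_basis sumEFin.
apply: cvg_EFin; first by near=> n.
rewrite /comp /= expr2; under eq_fun do rewrite expr2.
by apply: cvgM; apply: cvg_norm; exact: hu.2.
Unshelve. all: by end_near. Qed.

End orthonormal_basis.

Lemma least_spec (Q : set nat) : Q !=set0 ->
  Q (least Q) /\ forall m, Q m -> (least Q <= m)%N.
Proof.
move=> [n Qn]; rewrite /least.
have ex : exists n, `[< Q n >] by exists n; exact/asboolP.
have [m /asboolP Qm minm] := ex_minnP ex.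
have : [set m | Q m /\ forall m', Q m' -> (m <= m')%N] m.
  by split=> // m' Qm'; apply: minm; exact/asboolP.
by move/(xgetI 0%N); apply.
Qed.

Lemma least_set0 (Q : set nat) : ~ (Q !=set0) -> least Q = 0%N.
Proof.
move=> Q0; rewrite /least xgetPN// => m [Qm _].
by apply: Q0; exists m.
Qed.

Section truncated_svd_errors.
Context {R : realType} {d : measure_display} {T : measurableType d}.
Variables (X : completeNormedModType R) (ip : {dot X for idfun}) (u : nat -> X).
Hypotheses (hX : norm_from_dot ip) (hu : orthonormal_basis ip u).
Variables (omega0 omega lambda : R) (x : T -> X) (xi : nat -> T -> R).

(** The family of [gaussian_model], so that its independence transfers by conversion. *)
Definition gauss_coord (i : nat + nat) : T -> R :=
  match i with inl j => fun w => ip (x w) (u j) | inr j => xi j end.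

Definition weight (i : nat + nat) : R :=
  match i with inl j => 1 | inr j => (sing_val lambda j)^-1 end.

Local Notation D := (tdim omega0 omega).

Lemma ip_tsvd n w k : ip (tsvd omega0 omega ip u lambda x xi n w) (u k) =
  if (k < D n)%N then ip (x w) (u k) + (sing_val lambda k)^-1 * xi k w else 0.
Proof.
exact: (ip_sum_basis hu (fun j => ip (x w) (u j) + (sing_val lambda j)^-1 * xi
  j w)).
Qed.

(** Parseval: below [D n] the solution cancels and the amplified noise is left, from [D n] on the
    solution itself is left. *)
Lemma tsvd_error n w :
  (`|tsvd omega0 omega ip u lambda x xi n w - x w| ^+ 2)%:E =
  ((noise_err gauss_coord weight omega0 omega n w)%:E +
   bias_err gauss_coord weight omega0 omega n w)%E.
Proof.
rewrite (parseval hX hu) (@nneseries_split _ _ 0%N (D n)); last first.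
  by move=> k _; rewrite lee_fin sqr_ge0.
rewrite add0n; congr (_ + _)%E.
  rewrite sumEFin; congr (_%:E); apply: eq_big_nat => j /andP[_ jD].
  by rewrite linearBl /= ip_tsvd jD addrAC subrr add0r.
rewrite /bias_err -[LHS]nneseries_addn; last by move=> k; rewrite lee_fin sqr_ge0.
rewrite -[RHS]nneseries_addn; last by move=> k; rewrite lee_fin sqr_ge0.
apply: eq_eseriesr => j _; congr (_%:E).
by rewrite linearBl /= ip_tsvd ltnNge leq_addl sub0r sqrrN mul1r.
Qed.

Lemma noise_part_norm n w :
  `|noise_part omega0 omega u lambda xi n w| ^+ 2 =
  noise_err gauss_coord weight omega0 omega n w.
Proof.
rewrite /noise_part -(big_mkord xpredT (fun j => ((sing_val lambda j)^-1 * xi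
  j w) *: u j)).
by rewrite (norm_sum_basis hX hu).
Qed.

Lemma tsvd_diff n w : (1 < omega0) -> 1 < omega ->
  `|tsvd omega0 omega ip u lambda x xi n w -
    tsvd omega0 omega ip u lambda x xi n.+1 w| ^+ 2 =
  \sum_(D n <= j < D n.+1)
    (weight (inl j) * gauss_coord (inl j) w + weight (inr j) * gauss_coord
      (inr j) w) ^+ 2.
Proof.
move=> O1 om1; rewrite distrC /tsvd.
rewrite -!(big_mkord xpredT (fun j => (ip (x w) (u j) + (sing_val lambda j)^-1
  * xi j w) *: u j)).
rewrite (big_cat_nat _ (n := D n) (p := (trunc_level omega0 omega
  n.+1).-1))//=; last exact: tdim_leS.
rewrite addrAC subrr add0r (norm_sum_basis hX hu).
by apply: eq_bigr => j _; rewrite mul1r.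
Qed.

End truncated_svd_errors.

(** * The stopping rule of the balancing functional *)

Section fallback_parameter.
Context {R : realType} {d : measure_display} {T : measurableType d}.
Variable P : probability T R.
Variables (X : completeNormedModType R) (ip : {dot X for idfun}) (u : nat -> X).
Hypotheses (hX : norm_from_dot ip) (hu : orthonormal_basis ip u).
Variables (omega0 omega lambda sigma tau : R) (x : T -> X) (xi : nat -> T -> R).
Hypotheses (omega0_gt1 : 1 < omega0) (omega_gt1 : 1 < omega) (tau_ge1 : 1 <= tau).
Variable N : option nat.
Hypothesis look_aheadS : forall n : nat, lt_cap N (n%:R : R) ->
  look_ahead omega0 omega P u lambda xi N sigma n = n.+1.

Local Notation D := (tdim omega0 omega).
Local Notation V := (gauss_coord ip u x xi).
Local Notation c := (weight lambda).
Local Notation bal := (balancing omega0 omega P ip u lambda x xi N sigma).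
Local Notation adm := (fb_admissible omega0 omega P ip u lambda x xi N sigma tau).
Local Notation level := (noise_level omega0 omega P u lambda xi).

Hypothesis level_gt0 : forall n, 0 < level n.
Hypothesis mcoord : forall i, measurable_fun setT (V i).

Let block_sq n w :=
  \sum_(D n <= j < D n.+1) (c (inl j) * V (inl j) w + c (inr j) * V (inr j) w)
    ^+ 2.

(** The inequality tau <= b(n), squared, for a look-ahead of one step; 16 comes from the factor 1/4.
    The cap [N] is left out, so the event is defined at every level. *)
Definition exceeds n := [set w | 16 * tau ^+ 2 * level n.+1 ^+ 2 <= block_sq n w].

Lemma measurable_exceeds n : measurable (exceeds n).
Proof.
have mB : measurable_fun setT (block_sq n).
  apply: measurable_sum => j; apply: measurable_funX; apply: measurable_funD;
    by apply: measurable_funM.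
rewrite (_ : exceeds n = block_sq n @^-1` `[16 * tau ^+ 2 * level n.+1 ^+ 2,
  +oo[%classic).
  by rewrite -[X in measurable X]setTI; exact: mB.
by apply/seteqP; split => w /=; rewrite /exceeds /= in_itv/= andbT.
Qed.

(** By (a + b)^2 <= 2 a^2 + 2 b^2 and tau >= 1, the 16 becomes 8. *)
Lemma exceeds_le n w : exceeds n w -> 8 * level n.+1 ^+ 2 <=
  \sum_(D n <= j < D n.+1) (c (inl j) * V (inl j) w) ^+ 2 +
  \sum_(D n <= j < D n.+1) (c (inr j) * V (inr j) w) ^+ 2.
Proof.
rewrite /exceeds /= => h.
have h1 : block_sq n w <= 2 * (\sum_(D n <= j < D n.+1) (c (inl j) * V (inl j)
  w) ^+ 2 +
  \sum_(D n <= j < D n.+1) (c (inr j) * V (inr j) w) ^+ 2).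
  rewrite -big_split/= mulr_sumr ler_sum// => j _.
  set a := _ * _; set b := (sing_val _ _)^-1 * _.
  by have := sqr_ge0 (a - b); rewrite !expr2; lra.
have h2 : level n.+1 ^+ 2 <= tau ^+ 2 * level n.+1 ^+ 2.
  by rewrite ler_peMl ?sqr_ge0// exprn_ege1.
lra.
Qed.

(** By a^2 <= 2 (a + b)^2 + 2 b^2, with difference (a + 2 b)^2, the 16 becomes 32. *)
Lemma not_exceeds_le n w : ~ exceeds n w ->
  \sum_(D n <= j < D n.+1) (c (inl j) * V (inl j) w) ^+ 2 <=
  32 * tau ^+ 2 * level n.+1 ^+ 2 +
  2 * \sum_(D n <= j < D n.+1) (c (inr j) * V (inr j) w) ^+ 2.
Proof.
rewrite /exceeds /= => /negP; rewrite -ltNge => h.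
have h1 : \sum_(D n <= j < D n.+1) (c (inl j) * V (inl j) w) ^+ 2 <=
    2 * (block_sq n w + \sum_(D n <= j < D n.+1) (c (inr j) * V (inr j) w) ^+ 2).
  rewrite -big_split/= mulr_sumr ler_sum// => j _.
  set a := _ * _; set b := (sing_val _ _)^-1 * _.
  by have := sqr_ge0 (a + 2 * b); rewrite !expr2; lra.
lra.
Qed.

Lemma balancing_lt n w : lt_cap N (n%:R : R) -> (bal n w < tau) = ~~ (16 * tau
  ^+ 2 * level n.+1 ^+ 2 <= block_sq n w).
Proof.
move=> nN; rewrite /balancing look_aheadS// big_ltn// big_geq//.
set e := `|_|; have e0 : 0 <= e by exact: normr_ge0.
have l0 := level_gt0 n.+1.
rewrite max_l; last by rewrite mulr_ge0 ?invr_ge0 ?(ltW l0)// mulr_ge0.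
rewrite -ltNge /block_sq -(tsvd_diff hX hu lambda x xi n w omega0_gt1
  omega_gt1) -/e.
rewrite ltr_pdivrMr// mulrC ltr_pdivrMr//.
have -> : 16 * tau ^+ 2 * level n.+1 ^+ 2 = (tau * level n.+1 * 4) ^+ 2 by ring.
have t0 : 0 <= tau * level n.+1 * 4.
  by rewrite !mulr_ge0 ?(ltW l0)// (le_trans _ tau_ge1).
by rewrite ltr_pXn2r// nnegrE.
Qed.

(** At n = N the look-ahead range is empty, so the functional is 0. *)
Lemma balancing_cap n w : le_cap N (n%:R : R) -> ~~ lt_cap N (n%:R : R) -> bal
  n w < tau.
Proof.
case: N => [m|//] /=; rewrite ler_nat ltr_nat -leqNgt => nm mn.
rewrite /balancing big_geq; first by apply: lt_le_trans tau_ge1.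
by rewrite ltnS /look_ahead /= geq_min mn orbT.
Qed.

Lemma lt_cap_le n : lt_cap N (n%:R : R) -> le_cap N (n%:R : R).
Proof. by case: N => [m|]//=; exact: ltW. Qed.

(** A finite [N] is itself admissible; for infinite [N] any level outside [exceeds] is. *)
Lemma fb_admissible_nonempty w : ~ (\bigcap_n exceeds n) w -> adm w !=set0.
Proof.
move=> Nw; have [[m NE]|NE] : (exists m, N = Some m) \/ N = None.
- by case: N => [m|]; [left; exists m|right].
- exists m; split; first by rewrite NE /=.
  by apply: balancing_cap; rewrite NE /= ?ltxx.
have [n nE] : exists n, ~ exceeds n w.
  by apply: contrapT => h; apply: Nw => n _; apply: contrapT => nE; apply: h;
    exists n.
exists n; split; first by rewrite NE.
by rewrite balancing_lt ?NE//; apply/negP.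
Qed.

Lemma n_fb_lt_exceeds w i :
  (i < n_fb omega0 omega P ip u lambda x xi N sigma tau w)%N -> exceeds i w.
Proof.
(* Without an admissible level [least] returns 0, and no [i] lies below it. *)
have [ne|/least_set0] := pselect (adm w !=set0); last first.
  by rewrite /n_fb => ->.
have [[capn baln] minn] := least_spec ne; rewrite /n_fb => i_n.
have iN : lt_cap N (i%:R : R).
  move: capn i_n; case: N => [m|]//=; rewrite ler_nat ltr_nat => nm /leq_trans.
  exact.
apply: contrapT => Ei; have : adm w i.
  split; first exact: lt_cap_le.
  by rewrite balancing_lt//; apply/negP.
by move/minn; rewrite leqNgt i_n.
Qed.

(** As n_fb < nopt < N, the cap is not reached and the test at n_fb is the one-block comparison. *)
Lemma n_fb_not_exceeds w (nopt : R) : ~ (\bigcap_n exceeds n) w -> lt_cap N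
  nopt ->
  (n_fb omega0 omega P ip u lambda x xi N sigma tau w)%:R < nopt ->
  ~ exceeds (n_fb omega0 omega P ip u lambda x xi N sigma tau w) w.
Proof.
move=> /fb_admissible_nonempty /least_spec [[_ baln] _] optN nopt_n.
apply/negP; rewrite -balancing_lt//.
by move: optN nopt_n; case: N => [m|]//= h1 h2; exact: lt_trans h2 h1.
Qed.

End fallback_parameter.

Theorem theorem3p12 (R : realType) (X Y : completeNormedModType R)
    (ipX : {dot X for idfun}) (ipY : {dot Y for idfun})
    (hX : norm_from_dot ipX) (hY : norm_from_dot ipY)
    (u : nat -> X) (v : nat -> Y)
    (hu : orthonormal_basis ipX u) (hv : orthonormal_basis ipY v)
    (gamma lambda eps omega0 omega sigma tau : R)
    (A : X -> Y) (hA : has_svd ipX u v (sing_val lambda) A)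
    (hgamma : 1 / 2 < gamma) (hlambda : 0 < lambda)
    (heps : 0 < 2 * lambda + 2 * eps)
    (homega0 : 1 < omega0) (homega : 1 < omega)
    (homega0omega : omega0 + 1 < omega0 * omega)
    (hsigma : 1 < sigma) (htau : 1 <= tau)
    (h36 : 1 / 2 <= c3 lambda eps omega0 omega / c6 gamma lambda eps omega0)
    (h1 : 1 <= c1 gamma lambda eps omega0 omega * omega0 * omega
               / (2 * gamma - 1))
    (h41 : c4 lambda eps omega0 / c1 gamma lambda eps omega0 omega <= 2) :
  exists C : R,
    forall (d : measure_display) (T : measurableType d) (P : probability T R)
      (eta delta : R) (x : T -> X) (xi : nat -> T -> R)
      (N : option nat) (nopt : R),
    0 < eta -> 0 < delta ->
    gaussian_model P ipX u x xi eta delta gamma eps ->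
    is_n_opt gamma lambda eps omega0 omega eta delta nopt ->
    0 <= nopt -> lt_cap N nopt ->
    (forall n : nat, lt_cap N (n%:R : R) ->
       look_ahead omega0 omega P u lambda xi N sigma n = n.+1) ->
    {ae P, forall w, fb_admissible omega0 omega P ipX u lambda x xi
                       N sigma tau w !=set0} /\
    (mean_sq_error omega0 omega P ipX u lambda x xi
       (n_fb omega0 omega P ipX u lambda x xi N sigma tau)
     <= C%:E * ereal_inf (range (fun n : nat =>
          mean_sq_error omega0 omega P ipX u lambda x xi (fun=> n))))%E.
Proof.
have O_large := trunc_large hgamma heps homega0 homega h36.
pose g := 2 * gamma - 1; pose beta := 2 * lambda + 2 * eps.
have g_gt0 : 0 < g by rewrite /g; lra.
have beta_ge0 : 0 <= beta by exact: ltW.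
have b_gt0 : 0 < beta + 1 by rewrite ltr_wpDl.
have O0 : 0 < omega0 by exact: lt_trans homega0.
have om0 : 0 < omega by exact: lt_trans homega.
have gb_gt1 : 1 < omega `^ (g + (beta + 1)).
  rewrite -[ltLHS](_ : 1 `^ (g + (beta + 1)) = 1); last by rewrite powR1.
  by apply: gt0_ltr_powR; rewrite ?nnegrE ?(addr_gt0 g_gt0 b_gt0) ?(ltW om0).
(* [M] and [K] depend only on g, beta and omega, hence are fixed before eta and delta are
   introduced. *)
have [M HM] := bernoulli_archi
  (2 `^ (g + (beta + 1) + 1) * g / (beta + 1)) gb_gt1.
have a_gt0 : 0 < (8 * 2 `^ (beta + 1))^-1 :> R.
  by rewrite invr_gt0 mulr_gt0// powR_gt0.
have [K K_ge0 HK] := exp_tail_geometric homega a_gt0 (addr_ge0 (ltW b_gt0) ler01).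
pose cmin := Num.min (2 `^ (- g - 1) * g) (4 `^ (- (beta + 1)) * (beta + 1)) / 2.
have cmin_gt0 : 0 < cmin.
  by rewrite divr_gt0// lt_min !mulr_gt0// powR_gt0.
(* The numerator bounds the error at the stop, [cmin] the error at every fixed level from below,
   both in units of [U]. The absolute value gives the sign needed to multiply the infimum. *)
exists (`|@stopping_const R g beta omega tau M K| / cmin).
move=> d T P eta delta x xi N nopt eta_gt0 delta_gt0 model optE nopt_ge0 optN
  lookN.
pose V := gauss_coord ipX u x xi; pose c := weight lambda.
pose s (i : nat + nat) := match i with
  | inl j => eta * j.+1%:R `^ (- gamma) | inr j => delta * j.+1%:R `^ eps end.
have s_gt0 i : 0 < s i.
  by case: i => j; rewrite /s mulr_gt0// powR_gt0.
have c_gt0 i : 0 < c i.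
  by case: i => j; rewrite /c /weight// invr_gt0 powR_gt0.
have lawV i : normal_law P (V i) 0 (s i).
  by case: i => j; [exact: law_solution model j|exact: law_noise model j].
have mV i : measurable_fun setT (V i) by case: (lawV i).
have indV : mutually_independent P V by exact: independent_coordinates model.
have sqrpow (y a : R) : 0 < y -> (y `^ a) ^+ 2 = y `^ (2 * a).
  by move=> y0; rewrite (mulrC 2) powRrM powR_mulrn// powR_ge0.
have varX j : (c (inl j) * s (inl j)) ^+ 2 = eta ^+ 2 * j.+1%:R `^ (- g - 1).
  rewrite /c /s /= mul1r exprMn sqrpow//; congr (_ * _ `^ _); rewrite /g; ring.
have varZ j : (c (inr j) * s (inr j)) ^+ 2 = delta ^+ 2 * j.+1%:R `^ beta.
  rewrite /c /s /= /sing_val powRN invrK mulrCA -powRDp// exprMn sqrpow//.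
  by congr (_ * _ `^ _); rewrite /beta; ring.
(* The left side of the equation of n_opt. *)
pose U := eta ^+ 2 * omega0 `^ (- g) / g * omega `^ (nopt * - g).
have U_gt0 : 0 < U.
  by rewrite mulr_gt0 ?powR_gt0// divr_gt0// mulr_gt0 ?powR_gt0// exprn_gt0.
have optE' : U = delta ^+ 2 * omega0 `^ (beta + 1) / (beta + 1) * omega `^
  (nopt * (beta + 1)).
  rewrite /U; move: optE; rewrite /is_n_opt.
  by have -> : - 2 * gamma + 1 = - g by rewrite /g; ring.
have etaE : eta ^+ 2 = U * g * omega0 `^ g * omega `^ (g * nopt).
  rewrite /U (mulrC g nopt) mulrN !powRN.
  by field; rewrite !gt_eqF ?powR_gt0.
have deltaE : delta ^+ 2 =
    U * (beta + 1) * omega0 `^ (- (beta + 1)) * omega `^ (- (beta + 1) * nopt).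
  rewrite optE' mulNr (mulrC nopt) !powRN.
  by field; rewrite !gt_eqF ?powR_gt0.
pose level := noise_level omega0 omega P u lambda xi.
pose r n := level n ^+ 2.
pose nv n := delta ^+ 2 * \sum_(j < tdim omega0 omega n) j.+1%:R `^ beta.
have noiseE n : ('E_P[fun w => (`|noise_part omega0 omega u lambda xi n w| ^+
  2)%R] =
    \int[P]_w (noise_err V c omega0 omega n w)%:E)%E.
  rewrite unlock; apply: eq_integral => w _.
  by rewrite (noise_part_norm hX hu omega0 omega lambda x xi n w).
have noise_le n := mean_noise_err_le s_gt0 c_gt0 lawV omega0 omega varZ n.
have noise_ge n := mean_noise_err_ge s_gt0 c_gt0 lawV omega0 omega varZ n.
have nv_gt0 n : 0 < nv n.
  have := sum_powR_ge (tdim omega0 omega n) beta_ge0 => h.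
  rewrite mulr_gt0 ?exprn_gt0//; apply: lt_le_trans h.
  by rewrite powR_gt0// divr_gt0// ltr0n tdim_gt0.
have noise_fin n : (\int[P]_w (noise_err V c omega0 omega n w)%:E)%E \is a
  fin_num.
  rewrite ge0_fin_numE ?(le_lt_trans (noise_le n)) ?ltry//.
  by apply: le_trans (noise_ge n); rewrite lee_fin divr_ge0//;
    exact: ltW (nv_gt0 n).
(* [noise_level] is defined through [fine]; finiteness of the mean makes its square the true
   mean. *)
have rE n : (r n)%:E = (\int[P]_w (noise_err V c omega0 omega n w)%:E)%E.
  rewrite /r /level /noise_level noiseE sqr_sqrtr ?fineK//.
  by apply: fine_ge0; apply: le_trans (noise_ge n);
    rewrite lee_fin divr_ge0//; exact: ltW (nv_gt0 n).
have r_ge n : nv n <= 2 * r n.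
  by have := noise_ge n; rewrite -rE lee_fin -/(nv n); lra.
have r_le n : r n <= 6 * nv n.
  by have := noise_le n; rewrite -rE lee_fin.
have level_gt0 n : 0 < level n.
  rewrite lt_neqAle sqrtr_ge0 andbT eq_sym -sqrf_eq0 gt_eqF//.
  by have := nv_gt0 n; have := r_ge n; rewrite /r; lra.
pose E n := exceeds P ipX u omega0 omega lambda tau x xi n.
have mE n : measurable (E n) by exact: measurable_exceeds.
have EX n w : E n w -> 8 * r n.+1 <= _ := @exceeds_le _ _ _ P _ ipX u omega0
  omega lambda tau x xi htau n w.
pose F n := ~` E n.
have mF n : measurable (F n) by exact: measurableC.
have FX n w : F n w -> _ <= _ := @not_exceeds_le _ _ _ P _ ipX u omega0 omega
  lambda tau x xi n w.
pose m0 := `|Num.ceil nopt|%N.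
have m0E : m0%:R = (Num.ceil nopt)%:~R :> R.
  by rewrite -[LHS]/((Posz _)%:~R) gez0_abs// ceil_ge0 (lt_le_trans _ nopt_ge0).
have nopt_m0 : nopt <= m0%:R by rewrite m0E ceil_ge.
have m0_nopt : m0%:R < nopt + 1.
  by rewrite m0E; have := ceilB1_lt nopt; rewrite intrD; lra.
have mN : measurable (\bigcap_i E i) by exact: bigcapT_measurable.
have PN : P (\bigcap_i E i) = 0%E.
  exact: (null_bigcap_large s_gt0 c_gt0 lawV indV delta_gt0 g_gt0 beta_ge0 U_gt0
    homega0 homega O_large varX varZ etaE deltaE r_ge mE EX HM K_ge0 HK nopt_m0).
split.
  exists (\bigcap_i E i); split => // w /= Nadm; apply: contrapT => Nw;
    apply: Nadm.
  exact: (fb_admissible_nonempty hX hu homega0 homega htau lookN level_gt0).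
pose nf := n_fb omega0 omega P ipX u lambda x xi N sigma tau.
have errE (n : T -> nat) : mean_sq_error omega0 omega P ipX u lambda x xi n =
  (\int[P]_w ((noise_err V c omega0 omega (n w) w)%:E +
    bias_err V c omega0 omega (n w) w))%E.
  rewrite /mean_sq_error unlock; apply: eq_integral => w _.
  exact: (tsvd_error hX hu).
have inf_ge : ((cmin * U)%:E <= ereal_inf (range (fun n : nat =>
    mean_sq_error omega0 omega P ipX u lambda x xi (fun=> n))))%E.
  apply: le_ereal_inf_tmp => _ [n _ <-]; rewrite errE.
  exact: (mean_error_ge s_gt0 c_gt0 lawV g_gt0 beta_ge0 U_gt0 homega0 homega
    varX varZ etaE deltaE).
have nf_small w : ~ (\bigcap_i E i) w -> (nf w)%:R < nopt -> F (nf w) w.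
  move=> Nw nfn; exact: (n_fb_not_exceeds hX hu homega0 homega htau lookN
    level_gt0 Nw optN nfn).
have nf_large w i : (i < nf w)%N -> E i w.
  exact: (n_fb_lt_exceeds hX hu homega0 homega htau lookN level_gt0).
rewrite errE.
apply: (@le_trans _ _ (@stopping_const R g beta omega tau M K * U)%:E).
  exact: (stopped_error_le s_gt0 c_gt0 lawV indV eta_gt0 delta_gt0 g_gt0 beta_ge0
    U_gt0 nopt_ge0 homega0 homega O_large varX varZ etaE deltaE r_ge r_le mF mE
    FX EX HM K_ge0 HK nopt_m0 m0_nopt nf_small nf_large).
have C_ge0 : 0 <= `|@stopping_const R g beta omega tau M K| / cmin.
  by rewrite divr_ge0// ltW.
apply: (@le_trans _ _ ((`|@stopping_const R g beta omega tau M K| / cmin)%:E *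
    (cmin * U)%:E)%E); last by apply: lee_wpmul2l.
rewrite -EFinM lee_fin [leRHS]mulrA (divfK (lt0r_neq0 cmin_gt0)) ler_wpM2r
  ?(ltW U_gt0)//.
exact: ler_norm.
Qed.
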